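(* For $i=1,2$, let $K_i$ be a compact Hausdorff space, $E_i$ a Banach space, and $\mathcal{H}_i$ a closed subspace of $\mathcal{C}(K_i,E_i)$. Suppose that $E_2$ does not contain an isomorphic copy of $c_0$, and let $\mathcal{B}\subseteq K_2$ be a closed boundary for $\mathcal{H}_2$. Suppose that there exists an into isomorphism $T:\mathcal{H}_1\to\mathcal{H}_2$ with $\|T\|\,\|T^{-1}\|<3$. Then: (a) If $\alpha$ is an ordinal such that $\mathcal{W}_{\mathcal{H}_1}^{(\alpha)}$ is nonempty, then $\mathcal{B}^{(\alpha)}\cap\Omega_{\mathcal{H}_2}$ is nonempty. (b) If $\alpha$ is an ordinal such that $\mathcal{B}^{(\alpha)}\cap\Omega_{\mathcal{H}_2}$ is finite, then $\mathcal{W}_{\mathcal{H}_1}^{(\alpha)}$ is finite. (c) Let $\alpha$ be an ordinal such that $\mathcal{B}^{(\alpha)}\cap\Omega_{\mathcal{H}_2}$ is finite. Then $E_2^m$ contains an isomorphic copy of $E_1^n$, where $n=|\mathcal{W}_{\mathcal{H}_1}^{(\alpha)}|$ and $m=|\mathcal{B}^{(\alpha)}\cap\Omega_{\mathcal{H}_2}|$. In particular, if $E_1=E_2$ is a finite-dimensional space, then $n\le m$. (d) Suppose that $\mathcal{H}_1$ contains the constant functions. Then for every ordinal $\alpha$ such that $\mathcal{B}^{(\alpha)}\cap\Omega_{\mathcal{H}_2}$ is infinite, $|\mathcal{W}_{\mathcal{H}_1}^{(\alpha)}|\le|\mathcal{B}^{(\alpha)}\cap\Omega_{\mathcal{H}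_2}|$.
   Context: All topological spaces are Hausdorff; all Banach spaces are real and of dimension at least $1$ (this applies also to the subspaces $\mathcal{H}_i$). $|M|$ denotes the cardinality of a set $M$. For a compact space $K$ and a Banach space $E$, $\mathcal{C}(K,E)$ is the space of continuous functions $K\to E$ with the norm $\|f\|=\sup_{x\in K}\|f(x)\|$, and $\mathcal{C}(K)=\mathcal{C}(K,\mathbb{R})$. For $f\in\mathcal{C}(K)$ and $e\in E$, $f\otimes e\in\mathcal{C}(K,E)$ is $x\mapsto f(x)e$. For $e^*\in E^*$ and $h\in \mathcal{C}(K,E)$, $e^*(h)\in\mathcal{C}(K)$ is $x\mapsto\langle e^*,h(x)\rangle$. Let $\mathcal{H}\subseteq\mathcal{C}(K,E)$ be a closed subspace. - The canonical scalar function space of $\mathcal{H}$ is $\mathcal{A}=$ the closed linear span of $\{e^*(h): e^*\in E^*,\ h\in\mathcal{H}\}$ in $\mathcal{C}(K)$, and $\mathcal{A}^E=\{h\in\mathcal{A}: h\otimes e\in\mathcal{H}\text{ for every } e\in E\}$. - The Choquet boundary $\operatorname{Ch}_{\mathcal{H}}K$ is the set of all $x\in K$ such that the evaluation functional $h\mapsto h(x)$, $h\in\mathcal{A}$, is an extreme point of the unit ball $B_{\mathcal{A}^*}$. - A point $x\in K$ is a weak peak point (with respect to $\mathcal{H}$) if for each neighbourhood $U$ of $x$ and each $\varepsilon\in(0,1)$ there is $h\in\mathcal{A}^E$ with $0\le h\le1$, $h(x)>1-\varepsilon$ and $h<\varepsilon$ on $\operatorname{Ch}_{\mathcal{H}}K\setminus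 U$. $\mathcal{W}_{\mathcal{H}}$ is the set of all weak peak points of $K$ with respect to $\mathcal{H}$. - $\Omega_{\mathcal{H}}=\{y\in K:\ g(y)\ne0\text{ for some }g\in\mathcal{H}\}$. - A set $\mathcal{B}\subseteq K$ is a boundary for $\mathcal{H}$ if $\|h\|=\sup_{x\in\mathcal{B}}\|h(x)\|$ for each $h\in\mathcal{H}$; it is a closed boundary if in addition it is closed in $K$. For a topological space $S$ (subsets carry the subspace topology), $S^{(0)}=S$, $S^{(1)}$ is the set of accumulation points of $S$ in $S$, $S^{(\beta+1)}=(S^{(\beta)})^{(1)}$, and $S^{(\alpha)}=\bigcap_{\beta<\alpha}S^{(\beta)}$ for limit ordinals $\alpha$. An into isomorphism is a linear map that is an isomorphism onto its range (not necessarily surjective), and $T^{-1}$ is then defined on the range of $T$. $E^n$ denotes the direct sum of $n$ copies of $E$ (with $E^0=\{0\}$); ''contains an isomorphic copy of'' means contains a subspace linearly isomorphic to. *)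

(* Defs.v *)
From HB Require Import structures.
From mathcomp Require Import all_boot all_order all_algebra.
From mathcomp Require Import wochoice.
From mathcomp Require Import all_classical all_reals all_analysis.
Set Implicit Arguments.
Unset Strict Implicit.
Unset Printing Implicit Defensive.
Import Order.TTheory GRing.Theory Num.Theory numFieldNormedType.Exports.
Local Open Scope classical_set_scope.
Local Open Scope ring_scope.

(* A normed space is given by a linear subspace [D] of an [lmodType] together
   with a function [N] which is a norm on [D]; only the values of maps and norms
   on [D] matter. *)
Section normed_subspaces.
Context {R : realType}.

Definition linear_on (V W : lmodType R) (D : set V) (T : V -> W) :=
  forall (a : R) (u v : V), D u -> D v -> T (a *: u + v) = a *: T u + T v.

Definition bounded_on (V W : lmodType R) (D : set V) (N : V -> R)
    (N' : W -> R) (T : V -> W) :=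
  exists M : R, forall u, D u -> N' (T u) <= M * N u.

(* Only meaningful for maps satisfying [bounded_on]. *)
Definition opnorm (V W : lmodType R) (D : set V) (N : V -> R)
    (N' : W -> R) (T : V -> W) : R :=
  sup [set N' (T u) | u in D `&` [set u | N u <= 1]].

(* The inverse of [T], defined on the range [T @` D]. *)
Definition range_inv (V W : lmodType R) (D : set V) (T : V -> W) : W -> V :=
  'pinv_(fun=> 0) D T.

Definition into_isomorphism (V W : lmodType R) (D : set V) (N : V -> R)
    (D' : set W) (N' : W -> R) (T : V -> W) :=
  [/\ linear_on D T,
      (forall u, D u -> D' (T u)),
      {in D &, injective T},
      bounded_on D N N' T &
      bounded_on (T @` D) N' N (range_inv D T)].

(* [W] contains an isomorphic copy of [V]. *)
Definition contains_copy (V W : lmodType R) (D : set V) (N : V -> R)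
    (D' : set W) (N' : W -> R) :=
  exists T : V -> W, into_isomorphism D N D' N' T.

(* The value is 0 when [X] is empty. *)
Definition supnorm (X : Type) (E : normedModType R) (f : X -> E) : R :=
  sup (range (fun x => `|f x|)).

Definition contains_c0 (E : normedModType R) :=
  contains_copy [set u : nat -> R^o | u @ \oo --> (0 : R^o)]
    (@supnorm nat R^o) [set: E] Num.norm.

(* [E^n] is the space of functions ['I_n -> E], with the maximum norm. *)
Definition power_contains_copy (m : nat) (E' : normedModType R)
    (n : nat) (E : normedModType R) :=
  contains_copy [set: 'I_n -> E] (@supnorm 'I_n E)
    [set: 'I_m -> E'] (@supnorm 'I_m E').

Definition linear_span (V : lmodType R) (G : set V) : set V :=
  [set v | exists (n : nat) (c : 'I_n -> R) (g : 'I_n -> V),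
     (forall i, G (g i)) /\ v = \sum_(i < n) c i *: g i].

Definition finite_dimensional (V : lmodType R) :=
  exists G : set V, finite_set G /\ linear_span G = [set: V].

End normed_subspaces.

Section function_spaces.
Context {R : realType} {K : topologicalType} {E : normedModType R}.

(* [H] is a closed subspace of C(K, E), for [K] compact. *)
Definition closed_function_subspace (H : set (K -> E)) :=
  [/\ GRing.submod_closed [in H],
      (forall h, H h -> continuous h) &
      closed (H : set {uniform K -> E})].

Definition scalar_parts (H : set (K -> E)) : set (K -> R^o) :=
  [set f | exists (e' : {linear E -> R^o}) (h : K -> E),
     [/\ continuous e', H h & f = (fun x => e' (h x))]].

(* Uniform limits of continuous functions are continuous, so closing up among
   all functions [K -> R] is the same as closing up in C(K). *)
Definition scalar_space (H : set (K -> E)) : set (K -> R^o) :=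
  closure (linear_span (scalar_parts H) : set {uniform K -> R^o}).

Definition multiplier_space (H : set (K -> E)) : set (K -> R^o) :=
  [set f | scalar_space H f /\ forall e : E, H (fun x => f x *: e)].

(* The elements of the dual of [A] are represented by maps whose values outside
   [A] are irrelevant; accordingly they are compared on [A] only. *)
Definition dual_unit_ball (A : set (K -> R^o)) : set ((K -> R^o) -> R^o) :=
  [set phi | [/\ linear_on A phi, bounded_on A (@supnorm R K R^o) Num.norm phi &
     opnorm A (@supnorm R K R^o) Num.norm phi <= 1]].

Definition dual_ball_extreme (A : set (K -> R^o)) (phi : (K -> R^o) -> R^o) :=
  dual_unit_ball A phi /\
  forall (t : R) (phi1 phi2 : (K -> R^o) -> R^o), 0 < t < 1 ->
    dual_unit_ball A phi1 -> dual_unit_ball A phi2 ->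
    {in A, forall f, phi f = t *: phi1 f + (1 - t) *: phi2 f} ->
    {in A, phi1 =1 phi} /\ {in A, phi2 =1 phi}.

Definition Choquet_boundary (H : set (K -> E)) : set K :=
  [set x | dual_ball_extreme (scalar_space H) (fun f => f x)].

Definition weak_peak_points (H : set (K -> E)) : set K :=
  [set x | forall (U : set K) (eps : R), nbhs x U -> 0 < eps < 1 ->
     exists h : K -> R, [/\ multiplier_space H h,
       (forall y, 0 <= h y <= 1), 1 - eps < h x &
       forall y, (Choquet_boundary H `\` U) y -> h y < eps]].

Definition nonvanishing_points (H : set (K -> E)) : set K :=
  [set y | exists2 g, H g & g y != 0].

Definition boundary_for (H : set (K -> E)) (B : set K) :=
  forall h, H h -> supnorm h = sup [set `|h x| | x in B].

Definition closed_boundary_for (H : set (K -> E)) (B : set K) :=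
  closed B /\ boundary_for H B.

End function_spaces.

(* An ordinal is given as an element [a] of a well-ordered type [(I, r)]: it is
   the order type of the elements strictly below [a], and every ordinal arises
   in this way. *)
Section ordinals.
Context {I : Type} (r : rel I).

Definition wlt (b a : I) := r b a /\ b <> a.

Definition ord_zero (a : I) := forall b, ~ wlt b a.

Definition ord_succ (b a : I) := wlt b a /\ forall c, wlt c a -> r c b.

Definition ord_limit (a : I) := ~ ord_zero a /\ forall b, ~ ord_succ b a.

Hypothesis wo : well_order r.

Lemma well_order_refl (x : I) : r x x.
Proof.
have [|z [[+ zmin] _]] := wo (A := [pred t | `[< t = x >]]).
  by exists x; apply/asboolP.
move=> /asboolP zx; have := zmin x; rewrite zx; apply.
by apply/asboolP.
Qed.

Lemma well_order_anti (x y : I) : r x y -> r y x -> x = y.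
Proof.
move=> xy yx; have [|z [_ zuniq]] := wo (A := [pred t | `[< t = x \/ t = y >]]).
  by exists x; apply/asboolP; left.
rewrite -(zuniq x) ?(zuniq y) //; split.
- by apply/asboolP; right.
- by move=> t; move=> /asboolP[->|->] //; exact: well_order_refl.
- by apply/asboolP; left.
- by move=> t; move=> /asboolP[->|->] //; exact: well_order_refl.
Qed.

Lemma wlt_well_founded : well_founded wlt.
Proof.
move=> a; apply: contrapT => nacc.
have [|z [[+ zmin] _]] := wo (A := [pred x | `[< ~ Acc wlt x >]]).
  by exists a; apply/asboolP.
move=> /asboolP; apply; constructor=> y [ryz yz].
apply: contrapT => nay; apply: yz; apply: well_order_anti => //.
by apply: zmin; apply/asboolP.
Qed.

Context {X : topologicalType}.

(* The accumulation points of the subspace [S] in [S]. *)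
Definition derived_set (S : set X) : set X := S `&` limit_point S.

(* The three clauses (zero, successor, limit) of the transfinite recursion; see
   the lemmas below. *)
Definition cantor_derivative_step (S : set X) (a : I)
    (rec : forall b, wlt b a -> set X) : set X :=
  [set x | [/\ S x,
     (forall b (ba : wlt b a), ord_succ b a -> derived_set (rec b ba) x) &
     (ord_limit a -> forall b (ba : wlt b a), rec b ba x)]].

Definition cantor_derivative (S : set X) : I -> set X :=
  Fix wlt_well_founded (fun=> set X) (cantor_derivative_step S).

Lemma cantor_derivative_unfold (S : set X) (a : I) :
  cantor_derivative S a = cantor_derivative_step S (fun b (_ : wlt b a) => cantor_derivative S b).
Proof.
rewrite /cantor_derivative Fix_eq // => {}a f g fg; congr cantor_derivative_step.
by apply: functional_extensionality_dep => b;
  apply: functional_extensionality_dep => ba.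
Qed.

Lemma cantor_derivative_sub (S : set X) (a : I) : cantor_derivative S a `<=` S.
Proof. by move=> x; rewrite cantor_derivative_unfold => -[]. Qed.

Lemma cantor_derivative_zero (S : set X) (a : I) : ord_zero a -> cantor_derivative S a = S.
Proof.
move=> a0; apply/seteqP; split; first exact: cantor_derivative_sub.
move=> x Sx; rewrite cantor_derivative_unfold; split=> // [b ba|_ b ba];
by case: (a0 b).
Qed.

Lemma cantor_derivative_succ (S : set X) (b a : I) : ord_succ b a ->
  cantor_derivative S a = derived_set (cantor_derivative S b).
Proof.
move=> ba; apply/seteqP; split=> x; rewrite [cantor_derivative S a]cantor_derivative_unfold.
  by case=> _ /(_ b ba.1 ba).
move=> [xb xl]; split; first exact: cantor_derivative_sub xb.
- move=> c _ ca; have -> // : c = b.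
  by apply: well_order_anti; [exact: ba.2 ca.1 | exact: ca.2 ba.1].
- by case=> _ /(_ b).
Qed.

Lemma cantor_derivative_limit (S : set X) (a : I) : ord_limit a ->
  cantor_derivative S a = \bigcap_(b in [set b | wlt b a]) cantor_derivative S b.
Proof.
move=> al; apply/seteqP; split=> x.
  by rewrite cantor_derivative_unfold => -[_ _ /(_ al)].
move=> xb; rewrite cantor_derivative_unfold; split.
- have /existsNP[b /contrapT ba] := al.1.
  exact: cantor_derivative_sub (xb b ba).
- by move=> b _ /al.2.
- by move=> _ b; apply: xb.
Qed.

End ordinals.

(* Main.v *)
Require Import Defs.
From HB Require Import structures.
From mathcomp Require Import all_boot all_order all_algebra.
From mathcomp Require Import wochoice.
From mathcomp Require Import all_classical all_reals all_analysis.
From mathcomp Require Import ring lra.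
Set Implicit Arguments.
Unset Strict Implicit.
Unset Printing Implicit Defensive.
Import Order.TTheory GRing.Theory Num.Theory numFieldNormedType.Exports.
Local Open Scope classical_set_scope.
Local Open Scope card_scope.
Local Open Scope ring_scope.

(** Let [|T u| <= a |u|] and [|u| <= b |T u|] with [a b < 3].  Suppose [f] is
    close to a unit vector [e] near a weak peak point [x], that [|f| <= 1]
    approximately, and let [h] be a scalar function peaking at [x].  At a point
    [y] where [|T (f + 2 h e) y|] is at least about [3 / b], every [g] with
    [|f + 2 h e - 2 g e| <= 1] approximately satisfies [|T (g e) y| >= c] for a
    constant [c > 0] depending on [a] and [b] only, and likewise
    [|T f y| >= c] since [|2 h e - f| <= 1].  As one [y] serves finitely many
    [g]'s at once, the constant does not deteriorate in a transfinite induction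
    showing that [y] can be taken in the derivative of [B] of the same order as
    the derivative of the weak peak points containing [x].  At a successor step,
    if no such [y] were an accumulation point, finitely many points would serve
    infinitely many functions [h_n] peaking on disjoint sets, and since signed
    sums of the [h_n] are uniformly bounded, a subsequence of the [T (h_n e) y] would
    span a copy of c_0 in [E2].  The same dichotomy gives (b) and, with [f] constant,
    the finite-to-one map behind (d); applying the lower bound to
    [f = sum_i h_i e_i] gives (c). *)

(** * Limit points, compactness and cardinality *)

(** The members of [F] are a base of a proper filter on [Q]; a cluster point of this filter lies in
    every member because the members are closed. All later compactness arguments choosing one point
    for many conditions take this form. *)
Lemma compact_directed (X : topologicalType) (Q : set X) (F : set (set X)) :
  compact Q -> F !=set0 -> (forall C, F C -> [/\ closed C, C !=set0 & C `<=` Q]) ->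
  (forall C D, F C -> F D -> exists2 G, F G & G `<=` C `&` D) ->
  exists x, forall C, F C -> C x.
Proof.
move=> cQ [C0 FC0] Fcl Fdir.
have PF : ProperFilter (filter_from F id).
  apply: filter_from_proper; last by move=> C /Fcl[].
  apply: filter_from_filter; first by exists C0.
  by move=> C D FC FD; exact: Fdir.
have [|x [Qx clx]] := cQ _ PF; first by exists C0 => //; have [] := Fcl _ FC0.
exists x => C FC; have [clC _ _] := Fcl _ FC.
by apply: clC => U Ux; apply: clx => //; exists C.
Qed.

(** The sets containing all but finitely many points of [S] form a filter. Near a cluster point [x]
    there are points of each such set, in particular of [S] with [x] removed. *)
Lemma compact_infinite_limit_point (X : topologicalType) (Q S : set X) :
  compact Q -> infinite_set S -> S `<=` Q -> exists2 x, Q x & limit_point S x.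
Proof.
move=> cQ Sinf SQ; pose F : set_system X := [set A | finite_set (S `\` A)].
have PF : ProperFilter F.
  split; first by rewrite /F/= /not setD0.
  split.
  - by rewrite /F/= setDT.
  - by move=> A A'; rewrite /F/= setDIr finite_setU.
  - move=> A A' AA'; apply: sub_finite_set => x [Sx nA]; split => // ?.
    by apply: nA; exact: AA'.
have [|x [Qx clx]] := cQ _ PF.
  by rewrite /F/= (_ : _ `\` _ = set0)// -subset0 => x [/SQ].
exists x => // U Ux.
have [|y [[Sy yx] Uy]] := clx (S `\ x) U _ Ux.
  apply: (@sub_finite_set _ _ [set x]) => // z [Sz].
  by move=> nz; apply: contrapT => zx; apply: nz.
by exists y; split => //; exact/eqP.
Qed.

Lemma limit_point_infinite (X : topologicalType) (S : set X) (x : X) :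
  hausdorff_space X -> limit_point S x -> infinite_set S.
Proof.
move=> hX lx fS.
have cl : closed (S `\ x).
  apply: compact_closed => //; apply: finite_compact; exact: finite_setD.
have /lx[y [/eqP yx Sy]] : nbhs x (~` (S `\ x)).
  by apply: open_nbhs_nbhs; split; [exact: closed_openC|case=> _; exact].
by apply; split.
Qed.

Lemma limit_point_nbhs (X : topologicalType) (S U : set X) (x : X) :
  limit_point S x -> nbhs x U -> limit_point (S `&` U) x.
Proof.
move=> lx Ux V Vx; have [y [yx Sy [Vy Uy]]] := lx _ (filterI Vx Ux).
by exists y.
Qed.

Lemma limit_pointS (X : topologicalType) (S S' : set X) :
  S `<=` S' -> limit_point S `<=` limit_point S'.
Proof.
by move=> SS' x lx U /lx[y [yx Sy Uy]]; exists y; split => //; exact: SS'.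
Qed.

(** Shrink neighbourhoods [V n] of a limit point [z] of [S]: at each stage a point of [S] in [V n]
    is separated from [z], its neighbourhood stays inside [V n], and [V n.+1] avoids that
    neighbourhood. Hence all later neighbourhoods avoid it too. *)
Lemma infinite_disjoint_nbhs (X : topologicalType) (S : set X) :
  hausdorff_space X -> compact [set: X] -> infinite_set S ->
  exists (x : nat -> X) (U : nat -> set X), [/\ forall n, S (x n),
    forall n, open_nbhs (x n) (U n) & forall i j, i <> j -> U i `&` U j = set0].
Proof.
move=> hX cX Sinf; have [//|z _ lz] := compact_infinite_limit_point cX Sinf.
pose P (V V' : set X) (p : X * set X) :=
  [/\ S p.1, open_nbhs p.1 p.2 & p.2 `<=` V] /\
  [/\ open_nbhs z V', V' `<=` V & p.2 `&` V' = set0].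
have step (V : set X) : exists q : (X * set X) * set X,
    open_nbhs z V -> P V q.2 q.1.
  have [Vz|nVz] := pselect (open_nbhs z V); last by exists ((z, V), V).
  have [x [xz Sx Vx]] := lz _ (open_nbhs_nbhs Vz).
  move: hX; rewrite open_hausdorff => /(_ x z xz)[[A B] /= [Ax Bz] [oA oB AB]].
  have [Vo Vz0] := Vz.
  exists ((x, A `&` V), B `&` V) => _; split; split => //=.
  - by split; [exact: openI|split; [exact/set_mem|]].
  - by split; [exact: openI|split; [exact/set_mem|]].
  - by rewrite setIACA; move/eqP: AB => ->; rewrite set0I.
have /choice[s sP] := step.
pose V n := iter n (fun V => (s V).2) setT.
have Vz n : open_nbhs z (V n).
  by elim: n => [|n /sP[_ []]] //=; split => //; exact: openT.
have Vle m n : (m <= n)%N -> V n `<=` V m.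
  elim: n => [|n IH]; first by rewrite leqn0 => /eqP ->.
  rewrite leq_eqVlt => /orP[/eqP -> //|]; rewrite ltnS => /IH; apply: subset_trans.
  by have [_ []] := sP _ (Vz n).
have UV0 i j : (i < j)%N -> (s (V i)).1.2 `&` (s (V j)).1.2 = set0.
  move=> ij; rewrite -subset0 => y [yi yj].
  have [_ [_ _ <-]] := sP _ (Vz i); split => //; apply: (Vle i.+1 j ij).
  by have [[_ _ +] _] := sP _ (Vz j); apply.
exists (fun n => (s (V n)).1.1), (fun n => (s (V n)).1.2); split => [n|n|i j ij].
- by have [[]] := sP _ (Vz n).
- by have [[]] := sP _ (Vz n).
- have [/UV0//|/UV0 <-|//] := ltngtP i j; by rewrite setIC.
Qed.

Lemma infinite_injection (T : Type) (A : set T) : infinite_set A ->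
  exists2 f : nat -> T, injective f & forall n, A (f n).
Proof.
move=> /infiniteP/card_leP[f]; exists (fun n => val (f (to_setT n))) => [i j /val_inj|n].
  by move=> /(@inj _ _ _ f); rewrite !in_setT => /(_ isT isT) [].
exact/set_mem/valP.
Qed.

Lemma inj_card_leS (T U : Type) (A : set T) (B : set U) (f : T -> U) :
  {in A &, injective f} -> (forall x, A x -> B (f x)) -> A #<= B.
Proof.
move=> finj fAB; have /card_eqPle[_ Af] := inj_card_eq finj.
by apply: card_le_trans Af _; apply: subset_card_le => _ [x Ax <-]; exact: fAB.
Qed.

(* A maximal family of pairwise disjoint injective sequences covers all but
   finitely many points, and each sequence absorbs a factor [nat]. *)
Lemma infinite_card_setX_nat (T : Type) (A : set T) :
  infinite_set A -> A `*` [set: nat] #<= A.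
Proof.
move=> Ainf.
pose P (F : set (nat -> T)) :=
  (forall f, F f -> injective f /\ forall n, A (f n)) /\
  (forall f g i j, F f -> F g -> f i = g j -> f = g).
have [|F [[Finj Fdisj] Fmax]] := @Zorn_bigcup _ P.
  move=> G GP Gtot; split=> [f [F GF Ff]|f g i j [F GF Ff] [F' GF' F'g] fg].
    by have [+ _] := GP _ GF; apply.
  have [FF'|F'F] := Gtot _ _ GF GF'.
    by have [_ /(_ f g i j)] := GP _ GF'; apply => //; exact: FF'.
  by have [_ /(_ f g i j)] := GP _ GF; apply => //; exact: F'F.
pose L := A `\` [set f i | f in F & i in [set: nat]].
have Lfin : finite_set L.
  apply: contrapT => /infinite_injection[s sinj sL].
  have sdisj f i j : F f -> f i <> s j.
    by move=> Ff fs; have [_] := sL j; apply; exists f => //; exists i.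
  apply: (Fmax (F `|` [set s])).
    split; first exact: subsetUl.
    by move=> /(_ s) /(_ (or_intror erefl)) Fs; exact: (sdisj s 0 0 Fs).
  split=> [f [/Finj//|->]|f g i j]; first by split => // n; have [] := sL n.
  move=> [Ff|->] [Fg|->] //; first exact: Fdisj.
    by move=> /sdisj; case.
  by move=> /esym/sdisj; case.
have [f0 Ff0] : F !=set0.
  apply/set0P/eqP => F0; apply: Ainf; apply: sub_finite_set Lfin => x Ax.
  by split => // -[f]; rewrite F0.
have /countable_injP[l linj] := finite_set_countable Lfin.
(* The code of [a] is its sequence and its position there, tagged [false]; the finitely many points
   of [L] are attached to [f0] with their number under [l], tagged [true]. *)
pose Q (a : T) (p : (nat -> T) * (nat * bool)) := F p.1 /\
  if p.2.2 then [/\ p.1 = f0, L a & p.2.1 = l a] else a = p.1 p.2.1.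
have /choice[c cP] : forall a, exists p, A a -> Q a p.
  move=> a; have [Aa|] := pselect (A a); last by exists (f0, (0%N, true)).
  have [La|] := pselect (L a); first by exists (f0, (l a, true)).
  move=> /not_andP[//|/contrapT[f Ff [i _ fi]]].
  by exists (f, (i, false)) => _; split.
(* Position, tag and natural number are packed into one index of the same sequence. Disjointness of
   the family recovers the sequence from the value, and injectivity recovers the index. *)
apply: (@inj_card_leS _ _ _ _ (fun p => (c p.1).1 (pickle ((c p.1).2, p.2)))).
  move=> [a k] [a' k'] /set_mem[/= Aa _] /set_mem[/= Aa' _].
  have [Fa Qa] := cP a Aa; have [Fa' Qa'] := cP a' Aa'.
  move=> e; have e1 := Fdisj _ _ _ _ Fa Fa' e; move: e; rewrite -e1.
  have [i1 _] := Finj _ Fa.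
  move=> /i1/(pcan_inj pickleK) [e2 ->].
  move: Qa Qa'; rewrite -e2 -e1; case: ifP => _; last first.
    by move=> ea ea'; congr pair; rewrite ea ea'.
  move=> [_ La e] [_ La' e']; congr pair.
  by apply: linj; rewrite ?inE// -e -e'.
by move=> [a k] [/= Aa _]; have [/Finj[_ +] _] := cP a Aa; apply.
Qed.

(** Numbering the points of each finite fibre embeds [A] in the product of [B] and [nat], which is
    no larger than [B]. *)
Lemma finite_fibres_card_le (T U : Type) (A : set T) (B : set U) (f : T -> U) :
  infinite_set B -> (forall x, A x -> B (f x)) ->
  (forall y, B y -> finite_set (A `&` f @^-1` [set y])) -> A #<= B.
Proof.
move=> Binf fAB ffin; apply: card_le_trans (infinite_card_setX_nat Binf).
have /choice[l linj] : forall y, exists l : T -> nat,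
    B y -> {in A `&` f @^-1` [set y] &, injective l}.
  move=> y; have [/ffin/finite_set_countable/countable_injP[l lP]|] := pselect (B y).
    by exists l.
  by exists (fun=> 0%N).
apply: (@inj_card_leS _ _ _ _ (fun x => (f x, l (f x) x))).
  move=> x x' /set_mem Ax /set_mem Ax' [fx]; rewrite -fx.
  by apply: linj; rewrite ?inE//; exact: fAB.
by move=> x Ax; split => //; exact: fAB.
Qed.

(** * Hahn-Banach and spaces containing c_0 *)

Section norming_functional.
Variables (R : realType) (E : normedModType R).

(** Sublinear functionals below the norm. Homogeneity is stated as an inequality, which is easier to
    check for infima; applying it to the inverse scalar gives equality. *)
Definition subnorm (p : E -> R) :=
  [/\ forall x y, p (x + y) <= p x + p y,
      forall (a : R) x, 0 < a -> p (a *: x) <= a * p x &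
      forall x, p x <= `|x|].

Lemma subnorm0 p : subnorm p -> p 0 = 0.
Proof.
move=> [pD _ pN]; have := pD 0 0; have := pN 0.
by rewrite addr0 normr0 => p0 p0'; apply/le_anti; rewrite p0 -(lerD2l (p 0)) addr0.
Qed.

Lemma subnormZ p (a : R) x : subnorm p -> 0 <= a -> p (a *: x) = a * p x.
Proof.
move=> sp; rewrite le_eqVlt => /predU1P[<-|a0].
  by rewrite scale0r mul0r subnorm0.
have [_ pZ _] := sp; apply/le_anti; rewrite pZ//=.
rewrite -ler_pdivlMl//; have := pZ a^-1 (a *: x).
by rewrite invr_gt0 scalerA mulVf ?gt_eqF// scale1r; apply.
Qed.

Lemma subnormN p x : subnorm p -> - p (- x) <= p x.
Proof.
move=> sp; have [pD _ _] := sp; have := pD x (- x).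
by rewrite subrr subnorm0// => ?; lra.
Qed.

Lemma subnorm_ge p x : subnorm p -> - `|x| <= p x.
Proof.
move=> sp; apply: le_trans (subnormN x sp); rewrite lerN2 -normrN.
by case: sp.
Qed.

(** The last two hypotheses are what makes a pointwise infimum sublinear: each sum or multiple of
    values dominates a value of one member. They hold for chains and for the shifts of a single
    functional. *)
Lemma subnorm_inf (I : Type) (D : set I) (p : I -> E -> R) :
  D !=set0 -> (forall i x, D i -> - `|x| <= p i x) ->
  (forall i x, D i -> p i x <= `|x|) ->
  (forall i j x y, D i -> D j -> exists2 k, D k & p k (x + y) <= p i x + p j y) ->
  (forall i (a : R) x, D i -> 0 < a -> exists2 k, D k & p k (a *: x) <= a * p i x) ->
  exists2 q, subnorm q & forall i x, D i -> q x <= p i x.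
Proof.
move=> [i0 Di0] pge ple pD pZ; pose q x := inf [set p i x | i in D].
have qle i x : D i -> q x <= p i x.
  move=> Di; apply: ge_inf; last by exists i.
  by exists (- `|x|) => _ [j Dj <-]; exact: pge.
have q_ge x (r : R) : (forall i, D i -> r <= p i x) -> r <= q x.
  move=> h; apply: lb_le_inf; first by exists (p i0 x), i0.
  by move=> _ [j Dj <-]; exact: h.
exists q => //; split=> [x y|a x a0|x].
- rewrite -lerBlDl; apply: (q_ge _) => j Dj; rewrite lerBlDl -lerBlDr.
  apply: (q_ge x) => i Di; rewrite lerBlDr.
  by have [k Dk kij] := pD i j x y Di Dj; apply: le_trans kij; exact: qle.
- rewrite -ler_pdivrMl//; apply: (q_ge _) => i Di; rewrite ler_pdivrMl//.
  by have [k Dk ki] := pZ i a x Di a0; apply: le_trans ki; exact: qle.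
- exact: le_trans (qle i0 x Di0) (ple _ _ Di0).
Qed.

(** Take [q x] as the infimum of [p (x + t *: y) - t * p y] over [t >= 0]. The parameter [t = 0]
    gives [q <= p], and [t = 1] gives the bound at [- y]. *)
Lemma subnorm_shift p y : subnorm p ->
  exists q, [/\ subnorm q, forall x, q x <= p x & q (- y) <= - p y].
Proof.
move=> sp; have [pD pZ pN] := sp.
pose P (t : R) x := p (x + t *: y) - t * p y.
have Pge t x : 0 <= t -> - p (- x) <= P t x.
  move=> t0; rewrite /P -subnormZ//; have := pD (x + t *: y) (- x).
  by rewrite addrAC subrr add0r => h; lra.
have [|||||q sq qP] := @subnorm_inf _ [set t | 0 <= t] P.
- by exists 0 => /=.
- move=> t x t0; apply: le_trans (Pge _ _ t0); rewrite lerN2 -normrN.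
  exact: pN.
- move=> t x t0; rewrite /P -subnormZ// lerBlDr.
  by apply: le_trans (pD _ _) _; rewrite lerD2r.
- move=> t s x z t0 s0; exists (t + s); first exact: addr_ge0.
  rewrite /P scalerDl addrACA mulrDl.
  by have := pD (x + t *: y) (z + s *: y) => h; lra.
- move=> t a x t0 a0; exists (a * t); first exact: mulr_ge0 (ltW a0) _.
  by rewrite /P mulrBr mulrA lerD2r -scalerA -scalerDr pZ.
exists q; split => // [x|].
  by have := qP 0 x (lexx 0); rewrite /P scale0r addr0 mul0r subr0.
have := qP 1 (- y) ler01.
by rewrite /P scale1r addNr subnorm0// mul1r sub0r.
Qed.

Lemma minimal_subnorm p : subnorm p ->
  exists q, [/\ subnorm q, forall x, q x <= p x &
    forall q', subnorm q' -> (forall x, q' x <= q x) -> q' = q].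
Proof.
move=> sp; pose S := {q | subnorm q /\ forall x, q x <= p x}.
pose Rel (q q' : S) := `[< forall x, sval q' x <= sval q x >].
have [||||[q [sq qp]] qmin] := @Zorn S Rel.
- by move=> q; apply/asboolP.
- move=> q1 q2 q3 /asboolP h /asboolP h'; apply/asboolP => x.
  exact: le_trans (h' x) (h x).
- move=> [q1 h1] [q2 h2] /asboolP/= h /asboolP/= h'.
  have e : q1 = q2 by apply/funext => x; apply/le_anti; rewrite h h'.
  by subst q2; rewrite (Prop_irrelevance h1 h2).
- move=> A Atot; have [A0|/set0P/negP/negPn/eqP A0] := pselect (A !=set0); last first.
    by exists (exist _ p (conj sp (fun x => lexx (p x)))) => s; rewrite A0.
  have [||||q sq qP] := @subnorm_inf _ A (fun q => sval q) A0.
  + by move=> s x _; have [ss _] := svalP s; exact: subnorm_ge.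
  + by move=> s x _; have [[_ _ sN] _] := svalP s.
  + move=> s t x y As At.
    have [/asboolP h|/asboolP h] := Atot _ _ As At.
      exists t => //; have [[tD _ _] _] := svalP t.
      by apply: le_trans (tD _ _) _; rewrite lerD2r.
    exists s => //; have [[sD _ _] _] := svalP s.
    by apply: le_trans (sD _ _) _; rewrite lerD2l.
  + move=> s a x As a0; exists s => //; have [[_ sZ _] _] := svalP s.
    exact: sZ.
  have qp x : q x <= p x.
    have [s As] := A0; have [_ sp'] := svalP s.
    exact: le_trans (qP _ _ As) (sp' x).
  by exists (exist _ q (conj sq qp)) => s As; apply/asboolP => x; exact: qP.
exists q; split => // q' sq' q'q.
have q'p x : q' x <= p x by exact: le_trans (q'q x) (qp x).
have := qmin (exist _ q' (conj sq' q'p)).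
by move=> /(_ (asboolT q'q))/(congr1 sval).
Qed.

(** By minimality the shift of [q] along any [x] is [q] itself, so [q (- x) <= - q x] and [q] is
    odd. Subadditivity at the opposite points then gives additivity. *)
Lemma minimal_subnorm_linear q : subnorm q ->
  (forall q', subnorm q' -> (forall x, q' x <= q x) -> q' = q) ->
  forall (a : R) x y, q (a *: x + y) = a * q x + q y.
Proof.
move=> sq qmin; have [qD _ _] := sq.
have qN x : q (- x) = - q x.
  have [q' [sq' q'q h]] := subnorm_shift x sq.
  apply/le_anti; rewrite -{1}(qmin _ sq' q'q) h/=.
  by rewrite lerNl; exact: subnormN.
have qDe x y : q (x + y) = q x + q y.
  apply/le_anti; rewrite qD/=; have := qD (- x) (- y).
  by rewrite -opprD !qN => h; lra.
move=> a x y; rewrite qDe; congr (_ + _).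
have [a0|a0] := leP 0 a; first exact: subnormZ.
rewrite -[a]opprK scaleNr qN subnormZ ?mulNr// oppr_ge0; exact: ltW.
Qed.

(* Hahn-Banach: a minimal sublinear functional is linear, and shifting the norm
   along [v] beforehand forces the value at [v]. *)
Lemma norming_functional (v : E) : exists2 f : {linear E -> R^o},
  (forall u, `|f u| <= `|u|) & f v = `|v|.
Proof.
have sN : subnorm (fun x : E => `|x|).
  by split=> [x y|a x a0|x]; [exact: ler_normD|rewrite normrZ gtr0_norm|].
have [p [sp pN pv]] := subnorm_shift v sN.
have [q [sq qp qmin]] := minimal_subnorm sp.
have qlin := minimal_subnorm_linear sq qmin.
have ql : linear (q : E -> R^o) by move=> a x y; rewrite qlin.
pose qL := HB.pack (q : E -> R^o) (GRing.isLinear.Build _ _ _ _ _ ql) : {linear E -> R^o}.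
exists qL => [u|]; first by rewrite ler_norml subnorm_ge//=; case: sq.
have qNv : q (- v) = - q v.
  by have := qlin (-1) v 0; rewrite addr0 scaleN1r subnorm0// addr0 mulN1r.
apply/le_anti; apply/andP; split; first by case: sq.
by have := le_trans (qp (- v)) pv; rewrite qNv lerN2.
Qed.

End norming_functional.

Lemma contractive_linear_continuous (R : realType) (E F : normedModType R)
    (f : {linear E -> F}) :
  (forall u, `|f u| <= `|u|) -> continuous f.
Proof.
move=> fle; apply: bounded_linear_continuous; exists 1; split => // M M1.
apply: (filterS _ (nbhsx_ballx (0 : E) 1 ltr01)) => x.
rewrite -ball_normE /ball_/= sub0r normrN => x1.
exact: le_trans (fle x) (le_trans (ltW x1) (ltW M1)).
Qed.

(* Split [nat] into infinitely many infinite blocks: if no block works, choosing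
   a bad row in each block lowers the bound on the row sums by [eps]. *)
Lemma rosenthal (R : realType) (M : nat -> nat -> R) (eps K : R) : 0 < eps ->
  (forall m n, 0 <= M m n) ->
  (forall m (r : seq nat), uniq r -> \sum_(i <- r) M m i <= K) ->
  exists2 s : nat -> nat, injective s & forall k (r : seq nat), uniq r ->
    k \notin r -> \sum_(i <- r) M (s k) (s i) <= eps.
Proof.
move=> eps0 M0 MK.
(* The bound on the row sums is measured in units of [eps], so that a drop by [eps] is one step of
   an induction on [N]. *)
have [N KN] : exists N : nat, K <= N%:R * eps.
  exists (Num.truncn (K / eps)).+1; rewrite -ler_pdivrMr//.
  exact/ltW/truncnS_gt.
have {KN}MN m (r : seq nat) : uniq r -> \sum_(i <- r) M m i <= N%:R * eps.
  by move=> /(MK m) h; exact: le_trans h KN.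
elim: N M M0 {MK} MN => [|N IH] M M0 MN.
  exists id => // k r ur _; apply: le_trans (MN _ _ ur) _.
  by rewrite mul0r ltW.
pose j (p k : nat) := pickle (p, k).
have jinj p : injective (j p) by move=> k k' /(pcan_inj pickleK)[].
have [[p jp]|] := pselect (exists p, forall k (r : seq nat), uniq r ->
    k \notin r -> \sum_(i <- r) M (j p k) (j p i) <= eps); first by exists (j p).
move=> /forallNP nj.
have /choice[c cP] : forall p, exists c : nat * seq nat, [/\ uniq c.2,
    c.1 \notin c.2 & eps < \sum_(i <- c.2) M (j p c.1) (j p i)].
  move=> p; have /existsNP[k /existsNP[r]] := nj p.
  move=> /not_implyP[ur /not_implyP[kr /negP]].
  by rewrite -ltNge => h; exists (k, r).
pose s p := j p (c p).1.
have sinj : injective s by move=> p q /(pcan_inj pickleK)[].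
have [|p r ur|t tinj tP] := IH (fun p q => M (s p) (s q)); first by [].
  have [uc kc lec] := cP p.
  (* The bad columns of block [p] differ from all chosen indices [s q]: blocks are disjoint, and
     within block [p] the index [(c p).1] is not in [(c p).2]. Their mass can thus be subtracted
     from the row sum over [map s r]. *)
  have u : uniq (map s r ++ map (j p) (c p).2).
    rewrite cat_uniq !map_inj_uniq// ur uc andbT /=.
    apply/hasPn => _ /mapP[i ic ->]; apply/mapP => -[q qr].
    by move=> /(pcan_inj pickleK)[pq iq]; move: kc; rewrite pq -iq -pq ic.
  have := MN (s p) _ u; rewrite big_cat !big_map/= -natr1 mulrDl mul1r.
  by move=> h; rewrite -(lerD2r eps); apply: le_trans h; rewrite lerD2l ltW.
exists (s \o t); first exact: inj_comp.
by move=> k r ur kr; exact: tP.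
Qed.

Lemma into_isomorphism_of_bounds (R : realType) (V W : lmodType R)
    (D : set V) (N : V -> R) (D' : set W) (N' : W -> R) (T : V -> W) (M C : R) :
  linear_on D T -> (forall u, D u -> D' (T u)) -> {in D &, injective T} ->
  (forall u, D u -> N' (T u) <= M * N u) ->
  (forall u, D u -> N u <= C * N' (T u)) ->
  into_isomorphism D N D' N' T.
Proof.
move=> Tlin embD Tinj TM TC; split => //; first by exists M.
exists C => _ [u Du <-]; rewrite /range_inv pinvKV ?inE//; exact: TC.
Qed.

Lemma supnorm_ub (R : realType) (X : Type) (E : normedModType R) (f : X -> E)
    (r : R) : (forall x, `|f x| <= r) -> forall x, `|f x| <= supnorm f.
Proof.
move=> fr x; apply: ub_le_sup; last by exists x.
by exists r => _ [y _ <-].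
Qed.

Lemma supnorm_le (R : realType) (X : Type) (E : normedModType R) (f : X -> E)
    (r : R) : 0 <= r -> (forall x, `|f x| <= r) -> supnorm f <= r.
Proof.
move=> r0 fr; have [[x _]|/set0P/negP/negPn/eqP X0] := pselect ([set: X] !=set0).
  apply: ge_sup; first by exists (`|f x|), x.
  by move=> _ [y _ <-].
have -> : supnorm f = 0; last by [].
rewrite /supnorm [X in sup X](_ : _ = set0) ?sup0// -subset0 => t [y].
by rewrite X0.
Qed.

Lemma supnorm_ge0 (R : realType) (X : Type) (E : normedModType R) (f : X -> E) :
  0 <= supnorm f.
Proof.
rewrite /supnorm; have [[[y [x _ fx]] ub]|/sup_out->//] :=
  pselect (has_sup (range (fun x => `|f x|))).
by apply: le_trans (ub_le_sup ub (ex_intro2 _ _ x _ fx)); rewrite -?fx.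
Qed.

Section c0.
Variables (R : realType) (E : completeNormedModType R).

Lemma sum_bounded_scale (v : nat -> E) (C : R) (r : seq nat) (a : nat -> R) (A : R) :
  (forall a : nat -> R, (forall i, `|a i| <= 1) ->
    `|\sum_(i <- r) a i *: v i| <= C) ->
  0 <= A -> (forall i, i \in r -> `|a i| <= A) ->
  `|\sum_(i <- r) a i *: v i| <= C * A.
Proof.
move=> vC; rewrite le_eqVlt => /predU1P[<-|A0] aA.
  rewrite big_seq big1 ?normr0 ?mulr0// => i /aA.
  by rewrite normr_le0 => /eqP ->; rewrite scale0r.
pose b i := if i \in r then a i / A else 0.
have -> : \sum_(i <- r) a i *: v i = A *: \sum_(i <- r) b i *: v i.
  rewrite scaler_sumr; apply: eq_big_seq => i ir.
  by rewrite scalerA /b ir mulrCA divff ?gt_eqF// mulr1.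
rewrite normrZ gtr0_norm// mulrC ler_pM2r//; apply: vC => i; rewrite /b.
case: ifPn => [/aA|]; last by rewrite normr0.
by rewrite normrM normfV (gtr0_norm A0) ler_pdivrMr// mul1r.
Qed.

Let c0 := [set u : nat -> R^o | u @ \oo --> (0 : R^o)].

Lemma c0_bounded (a : nat -> R^o) i : c0 a -> `|a i| <= supnorm a.
Proof.
move=> /cvgP/cvg_seq_bounded[M [_ /(_ (M + 1))]] aM.
by apply: (@supnorm_ub _ _ _ _ (M + 1)) => n; apply: aM; rewrite ?ltrDl.
Qed.

Lemma c0_series_cvg (v : nat -> E) (C : R) (a : nat -> R^o) :
  (forall (r : seq nat) (a : nat -> R), uniq r -> (forall i, `|a i| <= 1) ->
    `|\sum_(i <- r) a i *: v i| <= C) ->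
  c0 a -> cvgn (series (fun i => a i *: v i)).
Proof.
move=> vC a0; apply/cauchy_cvgP/cauchy_seriesP => e e0.
have C0 : 0 <= C.
  have := vC [::] (fun=> 0) isT (fun=> _).
  by rewrite big_nil !normr0; apply => //; exact: ler01.
have d0 : 0 < e / (C + 1) by rewrite divr_gt0// ltr_wpDl.
have /cvgr0Pnorm_lt/(_ _ d0)[N _ aN] := a0.
exists ([set n | (N <= n)%N], setT); first by split; [exists N|exact: filterT].
move=> [m n] [/= Nm _]; have lt1 : C * (e / (C + 1)) < e.
  by rewrite mulrCA -{2}[e]mulr1 ltr_pM2l// ltr_pdivrMr ?mul1r ?ltrDl// ltr_wpDl.
apply: le_lt_trans lt1; apply: sum_bounded_scale; last 2 first.
- exact: ltW.
- move=> i; rewrite mem_index_iota => /andP[mi _]; apply/ltW/aN.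
  exact: leq_trans Nm mi.
- by move=> b; apply: vC; exact: iota_uniq.
Qed.

(* Bessaga-Pelczynski; the subsequence equivalent to the unit vector basis is
   found by Rosenthal's lemma applied to norming functionals of the [v n]. *)
Lemma contains_c0_of_bounded_sums (v : nat -> E) (c C : R) : 0 < c ->
  (forall n, c <= `|v n|) ->
  (forall (r : seq nat) (a : nat -> R), uniq r -> (forall i, `|a i| <= 1) ->
    `|\sum_(i <- r) a i *: v i| <= C) ->
  contains_c0 E.
Proof.
move=> c_gt0 vc vC.
have /choice[f fP] : forall n, exists f : {linear E -> R^o},
    (forall u, `|f u| <= `|u|) /\ f (v n) = `|v n|.
  by move=> n; have [f f1 f2] := norming_functional (v n); exists f.
have [|||s sinj sP] := @rosenthal R (fun m n => `|f m (v n)|) (c / 2) C.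
- by rewrite divr_gt0.
- by [].
(* With these signs as coefficients the row sum is the value of the contraction [f m] at a signed
   sum of the [v i], whose norm is at most [C]. *)
- move=> m r ur; pose a i := Num.sg (f m (v i) : R).
  have a1 i : `|a i| <= 1 by rewrite normr_sg; case: (_ != 0); rewrite ?lexx ?ler01.
  apply: le_trans (vC r a ur a1); apply: le_trans ((fP m).1 _).
  rewrite linear_sum; apply: le_trans (ler_norm _).
  by apply: ler_sum => i _; rewrite linearZ/= /GRing.scale/= normrEsg.
pose w n := v (s n).
have wC (r : seq nat) (a : nat -> R) : uniq r -> (forall i, `|a i| <= 1) ->
    `|\sum_(i <- r) a i *: w i| <= C.
  have /choice[g gP] : forall j, exists i, forall k, s k = j -> k = i.
    move=> j; have [[i ij]|nj] := pselect (exists i, s i = j).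
      by exists i => k kj; apply: sinj; rewrite kj.
    by exists 0%N => k kj; case: nj; exists k.
  have gs k : g (s k) = k by rewrite -(gP _ k erefl).
  move=> ur a1; have := vC (map s r) (a \o g); rewrite map_inj_uniq// ur.
  move=> /(_ isT (fun i => a1 (g i))); rewrite big_map.
  by under eq_bigr do rewrite /= gs.
have wcvg a (a0 : c0 a) := c0_series_cvg wC a0.
(* Apply the functional norming [w k] to the partial sum: the term of index [k] gives at least [c]
   times the absolute value of [a k], and by the choice of [s] the others give at most
   [c / 2 * supnorm a]. *)
have partial_ge a k n : c0 a -> (k < n)%N ->
    c * `|a k| - c / 2 * supnorm a <= `|series (fun i => a i *: w i) n|.
  move=> a0 kn; apply: le_trans ((fP (s k)).1 _).
  rewrite /series/= linear_sum (bigD1_seq k) ?mem_index_iota ?iota_uniq//=.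
  rewrite -big_filter; set r := [seq _ <- _ | _].
  have kr : k \notin r by rewrite mem_filter eqxx.
  have ur : uniq r by rewrite filter_uniq// iota_uniq.
  rewrite [f (s k) (a k *: _)]linearZ/= (fP (s k)).2.
  apply: le_trans (lerB_normD _ _); apply: lerB.
    by rewrite normrZ normr_id mulrC ler_wpM2l.
  apply: le_trans (ler_norm_sum _ _ _) _.
  apply: (@le_trans _ _ (\sum_(i <- r) `|f (s k) (v (s i))| * supnorm a)).
    apply: ler_sum => i _; rewrite [f _ (_ *: _)]linearZ normrZ mulrC ler_wpM2l//.
    exact: c0_bounded.
  by rewrite -mulr_suml ler_wpM2r ?supnorm_ge0// sP.
pose T a := limn (series (fun i => a i *: w i)).
have Tn a (a0 : c0 a) : (fun n => `|series (fun i => a i *: w i) n|) @ \oo --> `|T a|.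
  by apply: cvg_norm; exact: wcvg.
have T_ge a : c0 a -> supnorm a <= 2 / c * `|T a|.
  move=> a0.
  (* On the right [supnorm a] has total coefficient one half, so it is absorbed on the left; this
     produces the constant [2 / c]. *)
  have : supnorm a <= c^-1 * (`|T a| + c / 2 * supnorm a).
    apply: supnorm_le => [|k].
      by rewrite mulr_ge0 ?invr_ge0 ?addr_ge0 ?mulr_ge0 ?supnorm_ge0 ?divr_ge0// ltW.
    rewrite ler_pdivlMl// -lerBlDr -(cvg_lim _ (Tn a a0))//.
    apply: limr_ge; first by apply/cvg_ex; exists `|T a|; exact: Tn.
    by exists k.+1 => // n /= kn; exact: partial_ge.
  by rewrite ler_pdivlMl// [2 / c * _]mulrAC ler_pdivlMr// => h; lra.
have c0B a b : c0 a -> c0 b -> c0 (a - b).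
  by move=> a0 b0; rewrite /c0/= -[0]subr0; exact: cvgB.
have Tlin : linear_on c0 T.
  move=> k a b a0 b0; rewrite /T.
  have -> : series (fun i => (k *: a + b) i *: w i) =
      k *: series (fun i => a i *: w i) + series (fun i => b i *: w i).
    apply/funext => n; rewrite /series !fctE scaler_sumr -big_split/=.
    by apply: eq_bigr => i _; rewrite scalerA -scalerDl.
  rewrite limD ?limZl_tmp//; try by exact: wcvg.
  by apply: cvgZl_tmp; exact: wcvg.
exists T; apply: (into_isomorphism_of_bounds (M := C) (C := 2 / c)) => //.
- move=> a b /set_mem a0 /set_mem b0 Tab; apply/funext => i.
  have := le_trans (c0_bounded i (c0B _ _ a0 b0)) (T_ge _ (c0B _ _ a0 b0)).
  have -> : T (a - b) = 0.
    by rewrite -scaleN1r addrC Tlin// Tab scaleN1r addNr.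
  by rewrite normr0 mulr0 normr_le0 subr_eq0 => /eqP.
- move=> a a0; rewrite -(cvg_lim _ (Tn a a0))//.
  apply: limr_le; first by apply/cvg_ex; exists `|T a|; exact: Tn.
  apply: nearW => n; apply: sum_bounded_scale; rewrite ?supnorm_ge0//.
    by move=> b; apply: wC; exact: iota_uniq.
  by move=> i _; exact: c0_bounded.
Qed.

End c0.

(** * Extreme points of dual balls of function spaces *)

Lemma compact_max (R : realType) (X : topologicalType) (Q : set X) (f : X -> R^o) :
  compact Q -> closed Q -> Q !=set0 -> continuous f ->
  exists2 x, Q x & forall y, Q y -> f y <= f x.
Proof.
move=> cQ clQ [x0 Qx0] fc.
pose F := [set Q `&` [set x | f y <= f x] | y in Q].
have [|C [y Qy <-]|C D [y Qy <-] [z Qz <-]|x xF] := @compact_directed X Q F cQ.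
- by exists (Q `&` [set x | f x0 <= f x]), x0.
- split; [|by exists y; split => /=|by move=> z []].
  apply: closedI => //; apply: (preimage_closed _ (@closed_ge R (f y))).
  by move=> z _; exact: fc.
- have [yz|/ltW zy] := leP (f y) (f z).
    exists (Q `&` [set x | f z <= f x]); first by exists z.
    by move=> x [Qx /= zx]; split; split => //=; exact: le_trans yz zx.
  exists (Q `&` [set x | f y <= f x]); first by exists y.
  by move=> x [Qx /= yx]; split; split => //=; exact: le_trans zy yx.
- exists x; first by have [] := xF _ (ex_intro2 _ _ x0 Qx0 erefl).
  by move=> y Qy; have [] := xF _ (ex_intro2 _ _ y Qy erefl).
Qed.

Lemma continuous_norm_bounded (R : realType) (X : topologicalType)
    (E : normedModType R) (f : X -> E) :
  compact [set: X] -> continuous f -> exists r, forall x, `|f x| <= r.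
Proof.
move=> cX fc; have [x0|X0] := pselect ([set: X] !=set0); last first.
  by exists 0 => x; case: X0; exists x.
have nc : continuous (fun x => `|f x| : R^o).
  by move=> x; apply: cvg_norm; exact: fc.
have [x _ xm] := compact_max cX closedT x0 nc.
by exists `|f x| => y; exact: xm.
Qed.

Lemma supnormZ (R : realType) (X : Type) (E : normedModType R) (f : X -> E)
    (a : R) : (exists r, forall x, `|f x| <= r) ->
  supnorm (a *: f) = `|a| * supnorm f.
Proof.
move=> [r fr]; have afr x : `|(a *: f) x| <= `|a| * r.
  by rewrite normrZ ler_wpM2l.
apply/le_anti/andP; split.
  apply: supnorm_le => [|x]; first by rewrite mulr_ge0 ?supnorm_ge0.
  by rewrite normrZ ler_wpM2l// (supnorm_ub fr).
have [->|a0] := eqVneq a 0; first by rewrite normr0 mul0r supnorm_ge0.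
rewrite -ler_pdivlMl ?normr_gt0//; apply: supnorm_le => [|x].
  by rewrite mulr_ge0 ?invr_ge0 ?supnorm_ge0.
by rewrite ler_pdivlMl ?normr_gt0// -normrZ; exact: (supnorm_ub afr x).
Qed.

(** Normalise [u] when [N u] is positive; boundedness makes the supremum meaningful and settles the
    case [N u = 0]. The abstract form serves functionals in dual balls, the embedding and its
    inverse on the range. *)
Lemma opnorm_bound (R : realType) (V W : lmodType R) (D : set V) (N : V -> R)
    (N' : W -> R) (T : V -> W) :
  (forall u, D u -> 0 <= N u) ->
  (forall (a : R) u, D u -> D (a *: u)) ->
  (forall (a : R) u, D u -> N (a *: u) = `|a| * N u) ->
  (forall (a : R) u, D u -> N' (T (a *: u)) = `|a| * N' (T u)) ->
  bounded_on D N N' T ->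
  forall u, D u -> N' (T u) <= opnorm D N N' T * N u.
Proof.
move=> N0 DZ NZ NZ' [M NM] u Du; have := N0 u Du.
rewrite le_eqVlt => /predU1P[Nu|Nu].
  by have := NM u Du; rewrite -Nu !mulr0.
rewrite -ler_pdivrMr// mulrC -[(N u)^-1]gtr0_norm ?invr_gt0// -NZ'//.
apply: ub_le_sup; last first.
  exists ((N u)^-1 *: u) => //; split; first exact: DZ.
  by rewrite /= NZ// gtr0_norm ?invr_gt0// mulVf// gt_eqF.
exists `|M| => _ [v [Dv /= v1] <-]; apply: le_trans (NM v Dv) _.
apply: le_trans (ler_norm _) _; rewrite normrM ler_piMr//.
by rewrite ger0_norm// N0.
Qed.

Section choquet.
Variables (R : realType) (K : topologicalType) (A : set (K -> R^o)).
Hypotheses (cK : compact [set: K])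
  (Alin : forall (a : R) f g, A f -> A g -> A (a *: f + g))
  (Acont : forall f, A f -> continuous f).

(* [(x, b)] stands for the functional (-1)^b delta_x. *)
Definition signed_eval (p : K * bool) (f : K -> R^o) : R :=
  if p.2 then - f p.1 else f p.1.

Lemma opp_closed f : A f -> A (- f).
Proof.
move=> Af; have := Alin (-2) Af Af.
rewrite -{2}[f]scale1r -scalerDl (_ : -2 + 1 = -1 :> R) ?scaleN1r//.
by lra.
Qed.

Lemma linear_onN (phi : (K -> R^o) -> R^o) f :
  linear_on A phi -> A f -> phi (- f) = - phi f.
Proof.
move=> phil Af; have := phil (-2) _ _ Af Af.
rewrite -{2}[f]scale1r -scalerDl (_ : -2 + 1 = -1 :> R) ?scaleN1r//.
  by rewrite /GRing.scale/= => ->; ring.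
by lra.
Qed.

Lemma signed_eval_lin p (a : R) f g :
  signed_eval p (a *: f + g) = a * signed_eval p f + signed_eval p g.
Proof. by rewrite /signed_eval !fctE; case: p.2; rewrite // opprD mulrN. Qed.

Lemma signed_evalN p f : signed_eval p (- f) = - signed_eval p f.
Proof. by rewrite /signed_eval; case: p.2. Qed.

Lemma signed_eval_continuous f : A f -> continuous (signed_eval ^~ f : _ -> R^o).
Proof.
move=> /Acont fc [x b]; rewrite /signed_eval.
apply/cvgrPdist_lt => e e0; have /cvgrPdist_lt/(_ _ e0) := fc x.
move=> xe; exists ([set z | `|f x - f z| < e], [set b]); first by split.
move=> [z b'] /= [ze ->]; case: b => //.
by rewrite -opprB opprK addrC normrN // addrC.
Qed.

Lemma closed_signed_eval_ge f (r : R) : A f -> closed [set p | r <= signed_eval p f].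
Proof.
move=> Af; apply: (preimage_closed _ (@closed_ge R r)) => p _.
exact: signed_eval_continuous.
Qed.

Let cX : compact [set: K * bool].
Proof. by rewrite -setXTT; apply: compact_setX => //; exact: bool_compact. Qed.

Let cC (C : set (K * bool)) : closed C -> compact C.
Proof. by move=> clC; apply: (subclosed_compact clC cX). Qed.

(* [dominated phi C] says that [phi] is at most the support function of [C],
   i.e. that it lies in the closed convex hull of the signed evaluations in [C]. *)
Definition dominated (phi : (K -> R^o) -> R^o) (C : set (K * bool)) :=
  forall g, A g -> exists2 p, C p & phi g <= signed_eval p g.

(** This is the face property of the closed convex hull of [C] in the dual ball, expressed through
    the signed evaluations themselves, so that compactness of [K * bool] can be used in place of a
    topology on the dual. *)
Definition is_face (C : set (K * bool)) := [/\ closed C, C !=set0 &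
  forall (t : R) phi phi1 phi2, 0 < t < 1 -> dual_unit_ball A phi1 ->
    dual_unit_ball A phi2 ->
    {in A, forall f, phi f = t * phi1 f + (1 - t) * phi2 f} ->
    dominated phi C -> dominated phi1 C /\ dominated phi2 C].

Lemma dominatedS phi C D : C `<=` D -> dominated phi C -> dominated phi D.
Proof. by move=> CD h g /h[p Cp pg]; exists p => //; exact: CD. Qed.

Definition max_part (C : set (K * bool)) f :=
  [set p | C p /\ forall q, C q -> signed_eval q f <= signed_eval p f].

(* Compare [phi] with [C] at [s *: f + g] and let [s] tend to infinity. *)
Lemma dominated_max_part C f (phi : (K -> R^o) -> R^o) p0 :
  linear_on A phi -> A f -> closed C -> max_part C f p0 ->
  phi f = signed_eval p0 f -> dominated phi C -> dominated phi (max_part C f).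
Proof.
move=> phil Af clC [Cp0 p0max] phif phiC g Ag.
pose m := signed_eval p0 f.
pose F := [set [set p | C p /\ phi g <= signed_eval p g + s * (signed_eval p f - m)]
  | s in [set s : R | 0 < s]].
have Fcl s : 0 < s -> closed [set p | C p /\
    phi g <= signed_eval p g + s * (signed_eval p f - m)].
  move=> s0; have -> : [set p | C p /\
      phi g <= signed_eval p g + s * (signed_eval p f - m)] =
      C `&` [set p | phi g + s * m <= signed_eval p (s *: f + g)].
    apply/seteqP; split=> p [Cp]; rewrite /= signed_eval_lin => h; split => //;
      by move: h; rewrite mulrBr => h; lra.
  by apply: closedI => //; apply: closed_signed_eval_ge; exact: Alin.
have [|D [s /= s0 <-]|D1 D2 [s /= s0 <-] [t /= t0 <-]|p pF] := @compact_directed _ C F (cC clC).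
- by eexists; exists 1 => //=.
- split; [exact: Fcl| |by move=> p []].
  have [p Cp] := phiC _ (Alin s Af Ag).
  rewrite phil// signed_eval_lin phif => h; exists p; split => //.
  have {}h : s * m + phi g <= s * signed_eval p f + signed_eval p g := h.
  by rewrite mulrBr; lra.
- have mono p u v : C p -> u <= v -> v * (signed_eval p f - m) <= u * (signed_eval p f - m).
    by move=> Cp uv; apply: ler_wnM2r => //; rewrite subr_le0; exact: p0max.
  have [st|/ltW ts] := leP s t.
    eexists; first by exists t.
    move=> p [Cp h]; split; split => //; apply: le_trans h _.
    by rewrite lerD2l mono.
  eexists; first by exists s.
  move=> p [Cp h]; split; split => //; apply: le_trans h _.
  by rewrite lerD2l mono.
have Cp : C p by have [] := pF _ (ex_intro2 _ _ 1 ltr01 erefl).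
have ps s : 0 < s -> phi g <= signed_eval p g + s * (signed_eval p f - m).
  by move=> s0; have [] := pF _ (ex_intro2 _ _ s s0 erefl).
have pm : signed_eval p f = m.
  apply/le_anti; rewrite p0max//= leNgt; apply/negP => lt_m.
  pose d := m - signed_eval p f; have d0 : 0 < d by rewrite subr_gt0.
  (* Taken as [s], this number makes the right-hand side of [ps] smaller than [phi g]. *)
  have e0 : 0 < (`|signed_eval p g - phi g| + 1) / d.
    by rewrite divr_gt0// ltr_wpDl.
  have := ps _ e0; rewrite -[signed_eval p f - m]opprB -/d mulrN divfK ?gt_eqF//.
  by have := ler_norm (signed_eval p g - phi g); lra.
exists p; first by split => // q /p0max; rewrite pm.
by have := ps 1 ltr01; rewrite pm subrr mulr0 addr0.
Qed.

Lemma max_part_nonempty C f : A f -> closed C -> C !=set0 -> max_part C f !=set0.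
Proof.
move=> Af clC C0; have [p Cp pm] := compact_max (cC clC) clC C0 (signed_eval_continuous Af).
by exists p.
Qed.

(** Both ends of a convex combination have value at [f] at most the maximum over [C]. If the
    combination attains the maximum, so do both ends, and [dominated_max_part] applies to each. *)
Lemma is_face_max_part C f : A f -> is_face C -> is_face (max_part C f).
Proof.
move=> Af [clC C0 Cext]; have [p0 p0C'] := max_part_nonempty Af clC C0.
have [Cp0 p0max] := p0C'.
split; last 2 first.
- by exists p0.
- move=> t phi phi1 phi2 t01 b1 b2 phiE phiC'; have /andP[t0 t1] := t01.
  have phiC : dominated phi C by apply: dominatedS phiC' => p [].
  have [d1 d2] := Cext _ _ _ _ t01 b1 b2 phiE phiC.
  have le1 : phi1 f <= signed_eval p0 f.
    by have [p Cp pf] := d1 f Af; exact: le_trans pf (p0max _ Cp).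
  have le2 : phi2 f <= signed_eval p0 f.
    by have [p Cp pf] := d2 f Af; exact: le_trans pf (p0max _ Cp).
  (* Domination at [- f] bounds [phi f] from below by a value of [f] on the maximal part. *)
  have gef : signed_eval p0 f <= phi f.
    have [p [Cp pmax]] := phiC' _ (opp_closed Af).
    have [l1 _ _] := b1; have [l2 _ _] := b2.
    rewrite !phiE ?inE//; last exact: opp_closed.
    by rewrite signed_evalN !linear_onN//; have := pmax _ Cp0; lra.
  have e1 : phi1 f = signed_eval p0 f.
    apply/le_anti; rewrite le1/=; move: gef; rewrite phiE ?inE// => h.
    by nra.
  have e2 : phi2 f = signed_eval p0 f.
    apply/le_anti; rewrite le2/=; move: gef; rewrite phiE ?inE// => h.
    by nra.
  have [l1 _ _] := b1; have [l2 _ _] := b2.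
  by split; apply: (@dominated_max_part _ _ _ p0).
- have -> : max_part C f = C `&` [set p | signed_eval p0 f <= signed_eval p f].
    apply/seteqP; split=> p [Cp pm]; split => //; first exact: pm.
    by move=> q /p0max qp0; exact: le_trans qp0 pm.
  by apply: closedI => //; exact: closed_signed_eval_ge.
Qed.

(** For fixed [g], the points of a member [C] whose evaluation at [g] is at least [psi g] form a
    nonempty closed set; along a chain these sets have a common point, so domination passes to the
    intersection. *)
Lemma is_face_bigcap (F : set (set (K * bool))) :
  F !=set0 -> (forall C, F C -> is_face C) -> total_on F subset ->
  is_face (\bigcap_(C in F) C).
Proof.
move=> F0 Fface Ftot.
have Fmin C D : F C -> F D -> exists2 G, F G & G `<=` C `&` D.
  move=> FC FD; have [CD|DC] := Ftot _ _ FC FD.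
    by exists C => // p Cp; split => //; exact: CD.
  by exists D => // p Dp; split => //; exact: DC.
split.
- by apply: closed_bigI => C /Fface[].
- have [C FC|p pF] := @compact_directed _ setT F cX F0 _ Fmin.
    by have [clC C0 _] := Fface _ FC.
  by exists p => C; exact: pF.
- move=> t phi phi1 phi2 t01 b1 b2 phiE phiC.
  suff dom psi : (forall C, F C -> dominated psi C) ->
      dominated psi (\bigcap_(C in F) C).
    have h C : F C -> dominated phi1 C /\ dominated phi2 C.
      move=> FC; have [_ _ Cext] := Fface _ FC.
      apply: Cext phiE _ => //; apply: dominatedS phiC => p; exact.
    by split; apply: dom => C /h[].
  move=> psiF g Ag.
  pose G := [set C `&` [set p | psi g <= signed_eval p g] | C in F].
  have [|D [C FC <-]|D1 D2 [C1 F1 <-] [C2 F2 <-]|p pG] := @compact_directed _ setT G cX.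
  + by have [C FC] := F0; eexists; exists C.
  + have [clC _ _] := Fface _ FC; split => //.
      by apply: closedI => //; exact: closed_signed_eval_ge.
    by have [p Cp pg] := psiF _ FC _ Ag; exists p.
  + have [C3 F3 C312] := Fmin _ _ F1 F2; eexists; first by exists C3.
    by move=> p [/C312[? ?] ?]; split; split.
  + exists p; first by move=> C FC; have [] := pG _ (ex_intro2 _ _ C FC erefl).
    by have [C FC] := F0; have [] := pG _ (ex_intro2 _ _ C FC erefl).
Qed.

Lemma dual_unit_ball_le phi f (r : R) : dual_unit_ball A phi -> A f ->
  0 <= r -> (forall x, `|f x| <= r) -> `|phi f| <= r.
Proof.
move=> [phil phib phi1] Af r0 fr.
have A0 : A 0 by rewrite -[0](subrr f) -scaleN1r addrC; exact: Alin.
have phi0 : phi 0 = 0.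
  by have := linear_onN phil A0; rewrite oppr0 => h; lra.
have AZ (a : R) u : A u -> A (a *: u) by move=> Au; rewrite -[_ *: _]addr0; exact: Alin.
have Ab u : A u -> exists r, forall x, `|u x| <= r.
  by move=> /Acont; exact: continuous_norm_bounded.
have := @opnorm_bound _ _ _ A (@supnorm R K R^o) Num.norm phi _ AZ.
move=> /(_ (fun u _ => supnorm_ge0 u) (fun a u Au => supnormZ a (Ab u Au))).
move=> /(_ _ phib f Af) h; apply: le_trans (h _) _ => [a u Au|].
  by rewrite -[a *: u]addr0 phil// phi0 addr0 normrZ.
apply: (@le_trans _ _ (1 * supnorm f)); first by rewrite ler_wpM2r// supnorm_ge0.
by rewrite mul1r; exact: supnorm_le.
Qed.

(** With both signs available, the maximum of the signed evaluations of [g] is the maximum of its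
    absolute value, so every functional in the dual ball is dominated. *)
Lemma is_faceT : [set: K] !=set0 -> is_face setT.
Proof.
move=> [x _].
have dom psi : dual_unit_ball A psi -> dominated psi setT.
  move=> bpsi g Ag.
  have [p _ pm] := compact_max cX closedT (ex_intro _ (x, true) I) (signed_eval_continuous Ag).
  exists p => //; apply: le_trans (ler_norm _) (dual_unit_ball_le bpsi Ag _ _) => [|y].
    by have := pm (p.1, ~~ p.2) I; rewrite /signed_eval/=; case: p.2 => /= h; lra.
  rewrite ler_norml; have := pm (y, true) I; have := pm (y, false) I.
  by rewrite /signed_eval/= => h1 h2; apply/andP; split => //; rewrite lerNl.
split; [exact: closedT|by exists (x, true)|].
by move=> t phi phi1 phi2 _ b1 b2 _ _; split; exact: dom.
Qed.

Lemma dual_unit_ball_eval x : dual_unit_ball A (fun f => f x).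
Proof.
have b f : A f -> `|f x| <= supnorm f.
  by move=> /Acont/(continuous_norm_bounded cK)[r fr]; exact: (supnorm_ub fr).
split; first by [].
- by exists 1 => f Af; rewrite mul1r; exact: b.
- rewrite /opnorm; have [S0|/set0P/negP/negPn/eqP ->] :=
    pselect ([set `|u x| | u in A `&` [set u | supnorm u <= 1]] !=set0).
    apply: ge_sup => // _ [u [Au /= u1] <-]; exact: le_trans (b _ Au) u1.
  by rewrite sup0 ler01.
Qed.

Lemma dual_unit_ballN phi : dual_unit_ball A phi -> dual_unit_ball A (fun f => - phi f).
Proof.
move=> [phil [M phib] phi1]; split.
- by move=> a u v Au Av; rewrite phil// opprD scalerN.
- by exists M => u Au; rewrite normrN; exact: phib.
- by rewrite /opnorm; under eq_imagel do rewrite normrN.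
Qed.

(* A minimal face is a single signed evaluation, since it is its own [max_part]
   for every [g] in [A]; this replaces the theorems of Krein-Milman and Milman. *)
Lemma exists_choquet_max f : [set: K] !=set0 -> A f ->
  exists x, dual_ball_extreme A (fun g => g x) /\ forall y, `|f y| <= `|f x|.
Proof.
move=> K0 Af; have C0face := is_face_max_part Af (is_faceT K0).
set C0 := max_part _ f in C0face.
(* A maximal removable part [U] of [C0] leaves a minimal face; unions of removed parts correspond to
   intersections of faces. *)
have [|U [Uface Umax]] := @Zorn_bigcup _ (fun U => is_face (C0 `\` U)).
  move=> F Fface Ftot; have [F0|/set0P/negP/negPn/eqP ->] := pselect (F !=set0); last first.
    by rewrite bigcup_set0 setD0.
  have -> : C0 `\` \bigcup_(X in F) X = \bigcap_(D in [set C0 `\` X | X in F]) D.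
    apply/seteqP; split=> [p [Cp nF] _ [X FX <-]|p pF].
      by split => // Xp; apply: nF; exists X.
    have [X FX] := F0; split; first by have [] := pF _ (ex_intro2 _ _ X FX erefl).
    by move=> [Y FY Yp]; have [] := pF _ (ex_intro2 _ _ Y FY erefl).
  apply: is_face_bigcap.
  - by have [X FX] := F0; exists (C0 `\` X), X.
  - by move=> _ [X FX <-]; exact: Fface.
  - move=> _ _ [X FX <-] [Y FY <-]; have [XY|YX] := Ftot _ _ FX FY.
      by right; exact: setDS.
    by left; exact: setDS.
set C := C0 `\` U in Uface; have [clC [[x b] Cp] Cext] := Uface.
have const g q : A g -> C q -> signed_eval q g = signed_eval (x, b) g.
  move=> Ag Cq.
  suff CC' : C `<=` max_part C g.
    by apply/le_anti; rewrite (CC' _ Cp).2//= (CC' _ Cq).2.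
  (* Otherwise the complement of [max_part C g] could be removed as well, being strictly larger than
     [U]. *)
  apply: contrapT => nCC'; apply: (Umax (~` max_part C g)).
    split; first by move=> p Up [[_ nU] _]; exact: nU.
    move=> h; apply: nCC' => p Cpp; apply: contrapT => np.
    by case: Cpp => _; apply; exact: h.
  rewrite setDE setCK (_ : C0 `&` _ = max_part C g); last first.
    by apply/setIidr => p [[]].
  exact: is_face_max_part.
have domE phi : linear_on A phi -> dominated phi C ->
    {in A, forall g, phi g = signed_eval (x, b) g}.
  move=> phil phiC g /set_mem Ag; apply/le_anti/andP; split.
    by have [q Cq qg] := phiC g Ag; rewrite -(const g q).
  have [q Cq] := phiC _ (opp_closed Ag).
  by rewrite signed_evalN linear_onN// lerN2 (const g q).
have ext phi phi1 phi2 t : 0 < t < 1 -> dual_unit_ball A phi1 -> dual_unit_ball A phi2 ->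
    {in A, forall g, phi g = t * phi1 g + (1 - t) * phi2 g} ->
    {in A, forall g, phi g = signed_eval (x, b) g} ->
    {in A, forall g, phi1 g = phi g} /\ {in A, forall g, phi2 g = phi g}.
  move=> t01 b1 b2 phiE phix.
  have [|d1 d2] := Cext _ phi _ _ t01 b1 b2 phiE.
    by move=> g Ag; exists (x, b) => //; rewrite phix ?inE.
  have [l1 _ _] := b1; have [l2 _ _] := b2.
  by split=> g Ag; rewrite phix// domE.
exists x; split; last first.
  move=> y; have [[_ pm] _] := Cp.
  have := pm (y, true) I; have := pm (y, false) I; rewrite /signed_eval/=.
  case: b {Cp const domE ext pm} => h1 h2.
    rewrite ler_norml -normrN; apply/andP; split; last exact: le_trans h1 (ler_norm _).
    by rewrite lerNl; apply: le_trans h2 (ler_norm _).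
  rewrite ler_norml; apply/andP; split; last exact: le_trans h1 (ler_norm _).
  by rewrite lerNl; apply: le_trans h2 (ler_norm _).
split; first exact: dual_unit_ball_eval.
move=> t phi1 phi2 t01 b1 b2 phiE.
case: b Cp const domE ext => Cp const domE ext; last first.
  by apply: ext t01 b1 b2 phiE _ => g _.
(* For the negative sign extremality is known for minus the evaluation, so both given functionals
   are negated. *)
have [|g _|e1 e2] := ext (fun f => - f x) _ _ t t01 (dual_unit_ballN b1) (dual_unit_ballN b2).
- by move=> g /phiE ->; rewrite /GRing.scale/=; ring.
- by [].
by split=> g Ag; apply: oppr_inj; [exact: e1|exact: e2].
Qed.

End choquet.

(** * Function spaces and peaking functions *)

Lemma closure_uniformP (R : realType) (K : topologicalType) (S : set (K -> R^o))
    (f : K -> R^o) :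
  closure (S : set {uniform K -> R^o}) f <->
  forall e : R, 0 < e -> exists2 g, S g & forall x, `|f x - g x| < e.
Proof.
split=> [clf e e0|h U].
  have [|g [Sg /= fg]] := clf [set g | forall x, `|f x - g x| < e].
    apply/uniform_nbhs; exists [set p | `|p.1 - p.2| < e]; split.
      by rewrite -entourage_from_ballE; exists e => //= p; rewrite -ball_normE.
    by move=> g /= + x; apply.
  by exists g.
move=> /uniform_nbhs[P []]; rewrite -entourage_from_ballE => -[e /= e0 eP] PU.
have [g Sg fg] := h e e0; exists g; split => //; apply: PU => x _.
by apply: eP => /=; rewrite -ball_normE; exact: fg.
Qed.

Lemma linear_span_lin (R : realType) (V : lmodType R) (G : set V) (a : R) u v :
  linear_span G u -> linear_span G v -> linear_span G (a *: u + v).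
Proof.
move=> [n [c [g [gG ->]]]] [m [d [k [kG ->]]]].
exists (n + m)%N, (fun i => match fintype.split i with inl j => a * c j | inr j => d j end),
  (fun i => match fintype.split i with inl j => g j | inr j => k j end); split.
  by move=> i; case: (fintype.split i).
rewrite big_split_ord/= scaler_sumr; congr (_ + _); apply: eq_bigr => i _.
  by rewrite (unsplitK (inl i)) scalerA.
by rewrite (unsplitK (inr i)).
Qed.

Section function_space.
Variables (R : realType) (K : topologicalType) (E : normedModType R).
Variable (H : set (K -> E)).
Hypotheses (cK : compact [set: K]) (sH : closed_function_subspace H).

Lemma fspace_lin (a : R) u v : H u -> H v -> H (a *: u + v).
Proof. by have [[_ Hl] _ _] := sH => /mem_set Hu /mem_set Hv; exact/set_mem/Hl. Qed.

Lemma fspace0 : H 0.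
Proof. by have [[H0 _] _ _] := sH; exact/set_mem. Qed.

Lemma fspaceZ (a : R) u : H u -> H (a *: u).
Proof. by move=> Hu; rewrite -[_ *: _]addr0; apply: fspace_lin => //; exact: fspace0. Qed.

Lemma fspaceD u v : H u -> H v -> H (u + v).
Proof. by move=> Hu Hv; rewrite -[u]scale1r; exact: fspace_lin. Qed.

Lemma fspaceB u v : H u -> H v -> H (u - v).
Proof. by move=> Hu Hv; rewrite addrC -scaleN1r; exact: fspace_lin. Qed.

Lemma fspace_sum (I : Type) (r : seq I) (h : I -> K -> E) :
  (forall i, H (h i)) -> H (\sum_(i <- r) h i).
Proof.
move=> Hh; elim/big_ind: _ => //; first exact: fspace0.
exact: fspaceD.
Qed.

Lemma fspace_continuous h : H h -> continuous h.
Proof. by have [_ Hc _] := sH; exact: Hc. Qed.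

Lemma fspace_bounded h : H h -> exists r, forall x, `|h x| <= r.
Proof. by move=> /fspace_continuous; exact: continuous_norm_bounded. Qed.

Lemma fspace_supnorm_ge h x : H h -> `|h x| <= supnorm h.
Proof. by move=> /fspace_bounded[r hr]; exact: (supnorm_ub hr). Qed.

Lemma scalar_space_lin (a : R) f g :
  scalar_space H f -> scalar_space H g -> scalar_space H (a *: f + g).
Proof.
move=> /closure_uniformP Af /closure_uniformP Ag; apply/closure_uniformP => e e0.
have d0 : 0 < e / 2 / (`|a| + 1) by rewrite !divr_gt0// ltr_wpDl.
have [f' Sf ff'] := Af _ d0.
have [|g' Sg gg'] := Ag (e / 2); first by rewrite divr_gt0.
exists (a *: f' + g'); first exact: linear_span_lin.
move=> x; rewrite !fctE.
have -> : a *: f x + g x - (a *: f' x + g' x) = a *: (f x - f' x) + (g x - g' x).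
  by rewrite scalerBr opprD addrACA.
apply: le_lt_trans (ler_normD _ _) _; rewrite normrZ.
have h1 : `|a| * `|f x - f' x| <= e / 2.
  have := ltW (ff' x); rewrite ler_pdivlMr ?ltr_wpDl// => h.
  by apply: le_trans h; rewrite mulrC ler_wpM2l// lerDl.
by have := gg' x; lra.
Qed.

Lemma linear_span_continuous f : linear_span (scalar_parts H) f -> continuous f.
Proof.
move=> [n [c [g [gG ->]]]] x.
elim/big_ind: _ => [|u v uc vc|i _]; first exact: cvg_cst.
  exact: (continuousD uc vc).
apply: cvgZl_tmp.
have [e' [h [ec Hh ->]]] := gG i.
by apply: continuous_comp; [exact: fspace_continuous|exact: ec].
Qed.

Lemma scalar_space_continuous f : scalar_space H f -> continuous f.
Proof.
move=> /closure_uniformP Af x; apply/cvgrPdist_lt => e e0.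
have [|g /linear_span_continuous gc fg] := Af (e / 3); first by rewrite divr_gt0.
have /cvgrPdist_lt/(_ (e / 3)) : g @ x --> g x by exact: gc.
rewrite divr_gt0// => /(_ isT); apply: filterS => y gxy.
have -> : f x - f y = (f x - g x) + (g x - g y) - (f y - g y) by ring.
apply: le_lt_trans (ler_normB _ _) _.
have := ler_normD (f x - g x) (g x - g y).
by have := fg x; have := fg y; lra.
Qed.

Lemma scalar_space_comp (e' : {linear E -> R^o}) h :
  continuous e' -> H h -> scalar_space H (fun x => e' (h x)).
Proof.
move=> ec Hh; apply: subset_closure; exists 1%N, (fun=> 1), (fun=> fun x => e' (h x)).
split; first by move=> _; exists e', h.
by rewrite big_ord1 scale1r.
Qed.

Lemma scalar_choquet_max f : [set: K] !=set0 -> scalar_space H f ->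
  exists2 x, Choquet_boundary H x & forall y, `|f y| <= `|f x|.
Proof.
move=> K0 Af.
have [x [Cx xm]] := exists_choquet_max cK scalar_space_lin scalar_space_continuous K0 Af.
by exists x.
Qed.

(** Compose [h] with a functional norming [h x]: the resulting scalar function has its maximal
    absolute value on the Choquet boundary. Norm estimates are therefore checked only there, where
    peaking functions are controlled. *)
Lemma choquet_norming h (r : R) : H h ->
  (forall x, Choquet_boundary H x -> `|h x| <= r) -> forall x, `|h x| <= r.
Proof.
move=> Hh hr x; have [f fle fx] := norming_functional (h x).
have fA := scalar_space_comp (contractive_linear_continuous fle) Hh.
have [|z Cz zm] := scalar_choquet_max _ fA; first by exists x.
apply: le_trans (hr _ Cz); apply: le_trans (fle (h z)).
by apply: le_trans (zm x); rewrite fx normr_id.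
Qed.

Definition peaking (x : K) (U : set K) (eps : R) (h : K -> R) :=
  [/\ multiplier_space H h, forall y, 0 <= h y <= 1, 1 - eps < h x &
    forall y, (Choquet_boundary H `\` U) y -> h y < eps].

Lemma peakingS x (U V : set K) eps delta h : U `<=` V -> eps <= delta ->
  peaking x U eps h -> peaking x V delta h.
Proof.
move=> UV ed [mh h01 hx hU]; split => //.
  by apply: le_lt_trans hx; rewrite lerD2l lerN2.
by move=> y [Cy nV]; apply: lt_le_trans ed; apply: hU; split => // /UV.
Qed.

Lemma peaking_continuous x U eps h : peaking x U eps h -> continuous (h : K -> R^o).
Proof. by move=> [[/scalar_space_continuous]]. Qed.

Lemma peaking_fspace x U eps h (e : E) : peaking x U eps h -> H (fun y => h y *: e).
Proof. by move=> [[_]]. Qed.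

(** A function peaking at [x] attains its maximum at a Choquet point; with error one half this point
    cannot lie outside [U]. *)
Lemma weak_peak_closure x : weak_peak_points H x -> closure (Choquet_boundary H) x.
Proof.
move=> Wx U Ux; have [|h [[Ah _] h01 hx hU]] := Wx U 2^-1 Ux; first by lra.
have [|z Cz zm] := scalar_choquet_max _ Ah; first by exists x.
exists z; split => //; apply: contrapT => nUz.
have := hU z (conj Cz nUz); have := zm x.
have /andP[hz0 _] := h01 z; have /andP[hx0 _] := h01 x.
by rewrite !ger0_norm//; lra.
Qed.

(** A peaking function is small only at Choquet points off [U], but these accumulate at [z] within
    [V], and the bound passes to [z] by continuity. *)
Lemma peaking_small x U V eps h z : peaking x U eps h -> weak_peak_points H z ->
  nbhs z V -> U `&` V = set0 -> h z <= eps.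
Proof.
move=> bh Wz Vz UV; rewrite leNgt; apply/negP => hz.
have : nbhs z [set y | eps < h y].
  have hc : (h : K -> R^o) @ z --> (h z : R^o) by exact: peaking_continuous bh _.
  exact: (cvgr_gt _ hc).
move=> /(filterI Vz)/(weak_peak_closure Wz)[y [Cy [Vy /= hy]]].
have [_ _ _ /(_ y)] := bh; have nU : ~ U y.
  by move=> Uy; have : (U `&` V) y by []; rewrite UV.
by move=> /(_ (conj Cy nU)); rewrite ltNge ltW.
Qed.

(** A Choquet point lies in at most one [U i]. That term contributes at most 1 and each other term
    at most [eps i]; [choquet_norming] extends the bound to all points. *)
Lemma peaking_sum_le (I : eqType) (r : seq I) (x : I -> K) (U : I -> set K)
    (eps : I -> R) (h : I -> K -> R) (e : I -> E) (d : R) :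
  uniq r -> (forall i, i \in r -> peaking (x i) (U i) (eps i) (h i)) ->
  (forall i j, i \in r -> j \in r -> i != j -> U i `&` U j = set0) ->
  (forall i, i \in r -> 0 <= eps i) ->
  (forall i, i \in r -> `|e i| <= 1) -> \sum_(i <- r) eps i <= d ->
  forall z, `|(\sum_(i <- r) (fun y => h i y *: e i) : K -> E) z| <= 1 + d.
Proof.
move=> ur bh UU eps0 e1 epsd.
have Hsum : H (\sum_(i <- r) (fun y => h i y *: e i)).
  rewrite big_seq; elim/big_ind: _ => [||i ir]; [exact: fspace0|exact: fspaceD|].
  exact: peaking_fspace (bh i ir).
apply: choquet_norming => // z Cz; rewrite fct_sumE.
apply: le_trans (ler_norm_sum _ _ _) _.
apply: (@le_trans _ _ (\sum_(i <- r) ((`[< U i z >])%:R + eps i))).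
  rewrite big_seq [leRHS]big_seq; apply: ler_sum => i ir.
  have [_ h01 _ hU] := bh i ir; have /andP[h0 h1] := h01 z.
  rewrite normrZ ger0_norm//; apply: le_trans (ler_piMr h0 (e1 i ir)) _.
  case: asboolP => Uz; first by rewrite (le_trans h1)// lerDl eps0.
  by rewrite add0r ltW// hU.
rewrite big_split/= lerD//.
have [[i ir Uiz]|nU] := pselect (exists2 i, i \in r & U i z); last first.
  rewrite big_seq big1 ?ler01// => i ir; case: asboolP => // Uz.
  by case: nU; exists i.
rewrite (bigD1_seq i)//= asboolT// big_seq_cond big1 ?addr0// => j /andP[jr ji].
case: asboolP => // Ujz.
by have : (U j `&` U i) z by []; rewrite UU.
Qed.

End function_space.

(** * Transfer of derivatives *)

Section cantor_derivative_theory.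
Context {I : Type} {r : rel I} (wo : well_order r) {X : topologicalType}.
Implicit Types (S : set X) (a b : I).

Lemma well_order_total a b : r a b \/ r b a.
Proof.
have [|z [[+ zmin] _]] := wo (A := [pred t | `[< t = a \/ t = b >]]).
  by exists a; apply/asboolP; left.
by move=> /asboolP[<-|<-]; [left|right]; apply: zmin; apply/asboolP; [right|left].
Qed.

Lemma well_order_succ_le b c a : ord_succ r c a -> wlt r b a -> b = c \/ wlt r b c.
Proof.
by move=> [_ cmax] ba; have [->|bc] := EM (b = c); [left|right; split => //; exact: cmax].
Qed.

Lemma ord_zero_succ_limit a :
  [\/ ord_zero r a, exists b, ord_succ r b a | ord_limit r a].
Proof.
have [a0|na0] := EM (ord_zero r a); first by constructor 1.
have [sa|/forallNP ns] := EM (exists b, ord_succ r b a); first by constructor 2.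
by constructor 3.
Qed.

Lemma cantor_derivative_anti S b a :
  wlt r b a -> cantor_derivative wo S a `<=` cantor_derivative wo S b.
Proof.
elim/(well_founded_ind (wlt_well_founded wo)): a b => a IH b ba.
have [/(_ b ba)//|[c ca]|la] := ord_zero_succ_limit a.
  rewrite (cantor_derivative_succ wo S ca).
  have [->|bc] := well_order_succ_le ca ba; first by move=> x [].
  by move=> x [/(IH c ca.1 b bc)].
by rewrite (cantor_derivative_limit wo S la) => x; apply.
Qed.

Lemma closed_derived_set S : closed S -> closed (derived_set S).
Proof.
move=> clS x clx; split; first by apply: clS; apply: closure_subset clx => y [].
apply: contrapT => /existsNP[U /not_implyP[Ux nU]].
have [z [[Sz lz] Uz]] := clx U Ux.
have zx : z = x.
  by apply: contrapT => /eqP zx; apply: nU; exists z.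
by apply: nU; rewrite -zx; apply: lz; rewrite zx.
Qed.

Lemma closed_cantor_derivative S a : closed S -> closed (cantor_derivative wo S a).
Proof.
move=> clS; elim/(well_founded_ind (wlt_well_founded wo)): a => a IH.
have [a0|[c ca]|la] := ord_zero_succ_limit a.
- by rewrite (cantor_derivative_zero wo S a0).
- rewrite (cantor_derivative_succ wo S ca).
  exact/closed_derived_set/IH/ca.1.
- by rewrite (cantor_derivative_limit wo S la); exact: closed_bigI.
Qed.

End cantor_derivative_theory.

Lemma sum_half_powers_le1 (R : realType) (r : seq nat) :
  uniq r -> \sum_(i <- r) (2^-1 : R) ^+ i.+1 <= 1.
Proof.
move=> ur; have [N rN] : exists N, forall i, i \in r -> (i < N)%N.
  elim: r {ur} => [|j r [N rN]]; first by exists 0%N.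
  exists (maxn N j.+1) => i; rewrite inE leq_max => /predU1P[->|/rN ->//].
  by rewrite ltnSn orbT.
have rE : perm_eq r [seq i <- iota 0 N | i \in r].
  apply: uniq_perm => // [|i]; first by rewrite filter_uniq// iota_uniq.
  rewrite mem_filter mem_iota add0n/=; case: (boolP (i \in r)) => //= /rN ->//.
rewrite (perm_big _ rE) big_filter big_mkcond/=.
apply: (@le_trans _ _ (\sum_(i <- iota 0 N) (2^-1 : R) ^+ i.+1)).
  by apply: ler_sum => i _; case: ifP => // _; apply: exprn_ge0.
have -> : iota 0 N = index_iota 0 N by rewrite /index_iota subn0.
suff -> : \sum_(0 <= i < N) (2^-1 : R) ^+ i.+1 = 1 - 2^-1 ^+ N.
  by rewrite gerBl exprn_ge0.
elim: N {rN rE} => [|N IH]; first by rewrite big_geq// expr0 subrr.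
by rewrite big_nat_recr//= IH exprS; field.
Qed.

(** * Images of peaking functions under the embedding *)

Section transfer.
Variables (R : realType) (K1 K2 : topologicalType).
Variables (E1 : normedModType R) (E2 : completeNormedModType R).
Hypotheses (hK1 : hausdorff_space K1) (cK1 : compact [set: K1])
  (cK2 : compact [set: K2]).
Variables (H1 : set (K1 -> E1)) (H2 : set (K2 -> E2)).
Hypotheses (sH1 : closed_function_subspace H1) (sH2 : closed_function_subspace H2)
  (nc0 : ~ contains_c0 E2).
Variables (B : set K2) (T : (K1 -> E1) -> (K2 -> E2)) (a b : R).
Hypotheses (bB : closed_boundary_for H2 B) (Tlin : linear_on H1 T)
  (TH : forall u, H1 u -> H2 (T u))
  (Ta : forall u, H1 u -> supnorm (T u) <= a * supnorm u)
  (Tb : forall u, H1 u -> supnorm u <= b * supnorm (T u))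
  (a0 : 0 < a) (b0 : 0 < b).

Notation tens h e := (fun y => h y *: e).

Lemma emb0 : T 0 = 0.
Proof.
have := Tlin (-1) (fspace0 sH1) (fspace0 sH1).
by rewrite addr0 scaler0 scaleN1r addNr.
Qed.

Lemma embZ k u : H1 u -> T (k *: u) = k *: T u.
Proof.
by move=> Hu; have := Tlin k Hu (fspace0 sH1); rewrite !addr0 emb0 addr0.
Qed.

Lemma embD u v : H1 u -> H1 v -> T (u + v) = T u + T v.
Proof. by move=> Hu Hv; have := Tlin 1 Hu Hv; rewrite !scale1r. Qed.

Lemma embB u v : H1 u -> H1 v -> T (u - v) = T u - T v.
Proof. by move=> Hu Hv; have := Tlin (-1) Hv Hu; rewrite !scaleN1r addrC => ->; rewrite addrC. Qed.

Lemma emb_sum (J : Type) (r : seq J) (u : J -> K1 -> E1) :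
  (forall i, H1 (u i)) -> T (\sum_(i <- r) u i) = \sum_(i <- r) T (u i).
Proof.
move=> Hu; elim: r => [|i r IH]; first by rewrite !big_nil emb0.
by rewrite !big_cons embD ?IH//; exact: (fspace_sum sH1).
Qed.

Lemma emb_norm_le u y (k : R) : 0 <= k -> H1 u -> (forall x, `|u x| <= k) ->
  `|T u y| <= a * k.
Proof.
move=> k0 Hu uk; apply: le_trans (fspace_supnorm_ge cK2 sH2 _ (TH Hu)) _.
apply: le_trans (Ta Hu) _; rewrite ler_wpM2l ?(ltW a0)//.
exact: supnorm_le.
Qed.

Lemma emb_norm_attained u x (k : R) : H1 u -> 0 <= k -> b * k < `|u x| ->
  exists2 y, B y & k < `|T u y|.
Proof.
move=> Hu k0 ku; apply: contrapT => nB.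
have : supnorm (T u) <= k.
  have [_ ->] := bB; last exact: TH.
  have [[y By]|/set0P/negP/negPn/eqP ->] := pselect (B !=set0); last first.
    by rewrite image_set0 sup0.
  apply: ge_sup; first by exists `|T u y|, y.
  by move=> _ [z Bz <-]; rewrite leNgt; apply/negP => h; apply: nB; exists z.
rewrite -(ler_pM2l b0) => h; have := le_trans (Tb Hu) h.
by apply/negP; rewrite -ltNge; apply: lt_le_trans ku (fspace_supnorm_ge cK1 sH1 _ Hu).
Qed.

(** If [S] were infinite, choose functions peaking in disjoint neighbourhoods with errors
    [2^-1 ^+ n.+1]. One point [y0] of the finite set [C] serves infinitely many of them; their
    images at [y0] have norm at least [c], while sums with coefficients in the unit interval have
    norm at most [2 a]. This gives a copy of c_0 in [E2]. *)
Lemma peaking_finite (e : E1) (c : R) (C : set K2) (S : set K1) :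
  `|e| <= 1 -> 0 < c -> finite_set C ->
  (forall x, S x -> forall U eps, nbhs x U -> 0 < eps < 1 ->
    exists h, peaking H1 x U eps h /\ exists2 y, C y & c <= `|T (tens h e) y|) ->
  finite_set S.
Proof.
move=> e1 c0 Cfin Speaking; apply: contrapT => Sinf; apply: nc0.
have [x [U [Sx Ux UU]]] := infinite_disjoint_nbhs hK1 cK1 Sinf.
have eps01 n : 0 < (2^-1 : R) ^+ n.+1 < 1.
  by rewrite exprn_gt0//= exprn_ilt1//; lra.
have /choice[p pP] : forall n, exists p : (K1 -> R) * K2,
    [/\ peaking H1 (x n) (U n) (2^-1 ^+ n.+1) p.1, C p.2 & c <= `|T (tens p.1 e) p.2|].
  move=> n; have [h [bh [y Cy hy]]] := Speaking _ (Sx n) _ _ (open_nbhs_nbhs (Ux n)) (eps01 n).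
  by exists (h, y).
have [y0 yinf] : exists y0, infinite_set [set n | (p n).2 = y0].
  apply/not_existsP => yfin; apply: infinite_nat.
  have -> : [set: nat] = \bigcup_(y in C) [set n | (p n).2 = y].
    by apply/seteqP; split=> // n _; exists (p n).2 => //; have [] := pP n.
  by apply: bigcup_finite => // y _; apply: contrapT; exact: yfin.
have [s sinj sP] := infinite_injection yinf.
pose h i := (p (s i)).1.
have bh i : peaking H1 (x (s i)) (U (s i)) (2^-1 ^+ (s i).+1) (h i) by have [] := pP (s i).
apply: (@contains_c0_of_bounded_sums _ _ (fun i => T (tens (h i) e) y0) c (a * (1 + 1))) => //.
  by move=> i; have [_ _] := pP (s i); rewrite (sP i).
move=> r k ur k1.
have Hh i : H1 (fun y => h i y *: (k i *: e)) := peaking_fspace _ (bh i).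
have -> : \sum_(i <- r) k i *: T (tens (h i) e) y0 =
    T (\sum_(i <- r) (fun y => h i y *: (k i *: e))) y0.
  rewrite (emb_sum _ Hh) fct_sumE; apply: eq_bigr => i _.
  rewrite -[k i *: _ y0]/((k i *: T (tens (h i) e)) y0) -embZ; last exact: peaking_fspace (bh i).
  congr (T _ y0); apply/funext => y.
  by rewrite !fctE !scalerA mulrC.
apply: emb_norm_le => //; first exact: (fspace_sum sH1).
apply: (peaking_sum_le cK1 sH1 (x := fun i => x (s i)) (U := fun i => U (s i))
  (eps := fun i => 2^-1 ^+ (s i).+1)) => //.
- by move=> i j _ _ ij; apply: UU => /sinj/eqP; apply/negP.
- by move=> i _; rewrite normrZ mulr_ile1.
- by have := @sum_half_powers_le1 R (map s r); rewrite map_inj_uniq// big_map; apply.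
Qed.

Variables (eta c : R).
Hypotheses (eta0 : 0 < eta) (eta1 : eta < 1) (c0 : 0 < c)
  (etac : b * (2 * c + a * (1 + 5 * eta)) <= 3 * (1 - 2 * eta)).

Definition peaks_at (e : E1) (f : K1 -> E1) (x : K1) :=
  [/\ H1 f, forall z, `|f z| <= 1 + eta & `|f x - e| < eta].

(** The last clause keeps [f] small after subtraction of twice [g e]. For a function peaking where
    [f] is near [e], the slack is [eta] from [f] and [2 * eta] from the function off its peak. *)
Definition peaks_below (e : E1) (f : K1 -> E1) (x : K1) (g : K1 -> R) :=
  [/\ multiplier_space H1 g, forall z, 0 <= g z <= 1, 1 - eta < g x &
    forall z, `|f z - (2 * g z) *: e| <= 1 + 3 * eta].

Definition large_images (e : E1) (f : K1 -> E1) (G : seq (K1 -> R)) : set K2 :=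
  [set y | c <= `|T f y| /\ forall g, g \in G -> c <= `|T (tens g e) y|].

Lemma multiplier_fspace (e : E1) g : multiplier_space H1 g -> H1 (tens g e).
Proof. by move=> [_]. Qed.

Lemma closed_large_images e f G : H1 f ->
  (forall g, g \in G -> multiplier_space H1 g) -> closed (large_images e f G).
Proof.
move=> Hf HG.
have cl u : H1 u -> closed [set y | c <= `|T u y|].
  move=> Hu; apply: (preimage_closed _ (@closed_ge R c)) => y _.
  by apply: (@cvg_norm _ E2); exact: (fspace_continuous sH2 (TH Hu)).
have -> : large_images e f G = [set y | c <= `|T f y|] `&`
    \bigcap_(g in [set g | g \in G]) [set y | c <= `|T (tens g e) y|] by [].
apply: closedI; first exact: cl.
by apply: closed_bigI => g /HG mg; apply/cl/multiplier_fspace.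
Qed.

Lemma nbhs_peak e f x (G : seq (K1 -> R)) : peaks_at e f x ->
  (forall g, g \in G -> peaks_below e f x g) ->
  nbhs x [set z | `|f z - e| < eta /\ forall g, g \in G -> 1 - eta < g z].
Proof.
move=> [Hf _ fx] Gx.
have Nf : nbhs x [set z | `|f z - e| < eta].
  have : (fun z => `|f z - e| : R^o) @ x --> (`|f x - e| : R^o).
    by apply: cvg_norm; apply: cvgB; [exact: (fspace_continuous sH1 Hf)|exact: cvg_cst].
  by move=> /cvgr_lt; apply.
elim: G Gx => [|g G IH] Gx.
  by apply: filterS Nf => z fz; split.
have NG := IH (fun g' g'G => Gx g' (mem_behead (s := g :: G) g'G)).
have [mg _ gx _] := Gx g (mem_head _ _).
have gc : (g : K1 -> R^o) @ x --> (g x : R^o).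
  by have [/(scalar_space_continuous sH1) gc _] := mg; exact: gc.
apply: filterS (filterI NG (cvgr_gt _ gc _ gx)) => z [[fz Gz] gz]; split => //.
by move=> g'; rewrite inE => /predU1P[->//|/Gz].
Qed.

(** Let [h] peak inside the neighbourhood [U] where [f] is near [e] and every [g] near 1. On [U] the
    coefficients [2 h - 1] and [1 + 2 h - 2 g] are at most about 1 in absolute value, and at Choquet
    points off [U] the term [2 h e] is negligible. *)
Lemma peak_transfer_boundary e f x (G : seq (K1 -> R)) : weak_peak_points H1 x -> `|e| = 1 ->
  peaks_at e f x -> (forall g, g \in G -> peaks_below e f x g) ->
  B `&` large_images e f G !=set0.
Proof.
move=> Wx e1 fx Gx; have U_x := nbhs_peak fx Gx; have [Hf f1 fxe] := fx.
set U := [set _ | _] in U_x.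
have p0 := eta0; have p1 := eta1; have p2 := etac.
have eta2 : 0 < eta / 2 < 1 by lra.
have [h ph] := Wx U (eta / 2) U_x eta2.
have [mh h01 hx hU] := ph.
have Hh := multiplier_fspace e mh.
(* At [x] the function [f + 2 h e] has norm above [3 * (1 - 2 * eta)], so by [etac] its image
   exceeds [k] somewhere on [B]. *)
pose k := 2 * c + a * (1 + 5 * eta).
have k0 : 0 <= k by rewrite addr_ge0 ?mulr_ge0 ?addr_ge0 ?mulr_ge0// ltW.
have Hu : H1 (f + 2 *: tens h e) by apply: fspaceD => //; exact: fspaceZ.
have [|y By ky] := emb_norm_attained (x := x) Hu k0.
  apply: le_lt_trans etac _; rewrite !fctE scalerA.
  have -> : f x + (2 * h x) *: e = (1 + 2 * h x) *: e - (e - f x).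
    by rewrite scalerDl scale1r opprB [RHS]addrC subrKA.
  apply: lt_le_trans (lerB_normD _ _).
  rewrite normrZ e1 mulr1 normrN distrC; apply: lt_le_trans (lerB (ler_norm _) (ltW fxe)).
  by lra.
have bound u : H1 u -> (forall z, Choquet_boundary H1 z -> `|u z| <= 1 + 5 * eta) ->
    `|T u y| <= a * (1 + 5 * eta).
  move=> Hu' uC; apply: emb_norm_le => //; first by lra.
  exact: (choquet_norming cK1 sH1).
(* Subtracting an image of norm at most [a * (1 + 5 * eta)] from one above [k] leaves more than
   [2 * c]. This is used with [u = 2 h e - f] for the image of [f], and with [u = f + 2 h e - 2 g e]
   for that of [g e]. *)
have half u v : T (f + 2 *: tens h e) y - T u y = 2 *: v ->
    `|T u y| <= a * (1 + 5 * eta) -> c <= `|v|.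
  move=> uv uy; have := lerB_dist (T (f + 2 *: tens h e) y) (T u y).
  by rewrite uv normrZ ger0_norm// => h'; move: ky; rewrite /k; lra.
exists y; split => //; split.
  have Hw : H1 (2 *: tens h e - f) by apply: fspaceB => //; exact: fspaceZ.
  apply: (half (2 *: tens h e - f)).
    rewrite -[LHS]/((T (f + 2 *: tens h e) - T (2 *: tens h e - f)) y) -embB//.
    have -> : f + 2 *: tens h e - (2 *: tens h e - f) = 2 *: f.
      by rewrite opprB addrACA subrr addr0 scaler_nat mulr2n.
    by rewrite embZ.
  apply: bound => // z Cz; rewrite !fctE scalerA.
  have /andP[h0 h1] := h01 z.
  have [[fz _]|nUz] := pselect (U z).
    have -> : (2 * h z) *: e - f z = (2 * h z - 1) *: e - (f z - e).
      by rewrite scalerBl scale1r opprB addrA subrK.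
    apply: le_trans (ler_normB _ _) _; rewrite normrZ e1 mulr1.
    have : `|2 * h z - 1| <= 1 by rewrite ler_norml; lra.
    by lra.
  apply: le_trans (ler_normB _ _) _; rewrite normrZ e1 mulr1 ger0_norm ?mulr_ge0//.
  by have := f1 z; have := hU z (conj Cz nUz); lra.
move=> g gG; have [mg g01 gx gf] := Gx g gG.
have Hg := multiplier_fspace e mg.
have Hw : H1 (f + 2 *: tens h e - 2 *: tens g e) by apply: fspaceB => //; exact: fspaceZ.
apply: (half (f + 2 *: tens h e - 2 *: tens g e)).
  rewrite -[LHS]/((T (f + 2 *: tens h e) - T (f + 2 *: tens h e - 2 *: tens g e)) y) -embB//.
  by rewrite opprB addrCA subrr addr0 embZ.
apply: bound => // z Cz; rewrite !fctE !scalerA.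
have /andP[h0 h1] := h01 z; have /andP[g0 g1] := g01 z.
have [[fz /(_ g gG) gz]|nUz] := pselect (U z).
  have -> : f z + (2 * h z) *: e - (2 * g z) *: e =
      (1 + 2 * h z - 2 * g z) *: e + (f z - e).
    by rewrite scalerBl scalerDl scale1r [RHS]addrC -!addrA addKr.
  apply: le_trans (ler_normD _ _) _; rewrite normrZ e1 mulr1.
  have : `|1 + 2 * h z - 2 * g z| <= 1 + 2 * eta by rewrite ler_norml; lra.
  by lra.
rewrite addrAC; apply: le_trans (ler_normD _ _) _.
rewrite [`|_ *: e|]normrZ e1 mulr1 [`|2 * _|]ger0_norm ?mulr_ge0//.
by have := gf z; have := hU z (conj Cz nUz); lra.
Qed.

(** The list [G] is arbitrary so that the induction can add one more function. At a successor, if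
    the derived set misses the closed set [large_images e f G], compactness makes the intersection
    [C] at the previous stage finite; the induction hypothesis at nearby points then contradicts
    [peaking_finite]. *)
Lemma peak_transfer (I : Type) (r : rel I) (wo : well_order r) (al : I)
    e f x (G : seq (K1 -> R)) :
  cantor_derivative wo (weak_peak_points H1) al x -> `|e| = 1 ->
  peaks_at e f x -> (forall g, g \in G -> peaks_below e f x g) ->
  cantor_derivative wo B al `&` large_images e f G !=set0.
Proof.
move=> + e1; elim/(well_founded_ind (wlt_well_founded wo)): al x G => al IH x G Wx fx Gx.
have [clB _] := bB.
have cB : compact B by apply: subclosed_compact clB cK2 _.
have WW : weak_peak_points H1 x by exact: cantor_derivative_sub Wx.
have [Hf f1 fxe] := fx.
have clL : closed (large_images e f G).
  by apply: closed_large_images => // g /Gx[].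
have [z|[be ba]|la] := @ord_zero_succ_limit I r al.
- by rewrite (cantor_derivative_zero wo B z); exact: peak_transfer_boundary Gx.
- rewrite (cantor_derivative_succ wo B ba).
  move: Wx; rewrite (cantor_derivative_succ wo _ ba) => -[_ lx].
  set Bb := cantor_derivative wo B be; set Wb := cantor_derivative wo _ be in lx.
  have clBb : closed Bb by exact: closed_cantor_derivative.
  have cBb : compact Bb.
    by apply: subclosed_compact clBb cB _; exact: cantor_derivative_sub.
  have [C0|/set0P/negP/negPn/eqP C0] :=
    pselect (derived_set Bb `&` large_images e f G !=set0); first exact: C0.
  pose C := Bb `&` large_images e f G.
  have Cfin : finite_set C.
    apply: contrapT => Cinf.
    have [|y By ly] := compact_infinite_limit_point cBb Cinf; first by move=> y [].
    have /(_ y) : derived_set Bb `&` large_images e f G `<=` set0 by rewrite C0.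
    apply; split; first by split => //; apply: (limit_pointS _ ly) => ? [].
    by apply: clL; apply: subset_limit_point; apply: (limit_pointS _ ly) => ? [].
  have U_x := nbhs_peak fx Gx.
  have [] := limit_point_infinite hK1 (limit_point_nbhs lx U_x).
  apply: (@peaking_finite e _ _ _ _ c0 Cfin); first by rewrite e1.
  move=> z [Wz Uz]; have [fz Gz] := Uz => V eps Vz eps01.
  have Wpz : weak_peak_points H1 z by exact: cantor_derivative_sub Wz.
  have p0 := eta0; have p1 := eta1; have /andP[eps0 eps1] := eps01.
  have Mn01 : 0 < Num.min eps eta < 1 by rewrite lt_min eps0 p0 gt_min p1 orbT.
  have pfz : peaks_at e f z by [].
  (* Only the condition [1 - eta < g x] depends on the point, and it holds at [z] by the choice of
     the neighbourhood. *)
  have pGz g : g \in G -> peaks_below e f z g.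
    by move=> gG; have [mg g01 _ gf] := Gx g gG; split => //; exact: Gz.
  have [h ph] := Wpz _ _ (filterI Vz (nbhs_peak pfz pGz)) Mn01.
  have [mh h01 hz hU] := ph.
  have hz' : 1 - eta < h z.
    by apply: le_lt_trans hz; rewrite lerD2l lerN2 ge_min lexx orbT.
  have phz : peaks_below e f z h.
    split => //.
    have Hw : H1 (f - 2 *: tens h e).
      by apply: fspaceB => //; apply: fspaceZ => //; exact: multiplier_fspace.
    have wE w : f w - (2 * h w) *: e = (f - 2 *: tens h e) w.
      by rewrite !fctE scalerA.
    move=> w; rewrite wE; apply: (choquet_norming cK1 sH1 Hw) => {}w Cw.
    rewrite -wE.
    have /andP[h0 h1] := h01 w.
    have [[_ [fw _]]|nUw] := pselect ((V `&` [set w | `|f w - e| < eta /\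
      forall g, g \in G -> 1 - eta < g w]) w).
      have -> : f w - (2 * h w) *: e = (1 - 2 * h w) *: e + (f w - e).
        by rewrite scalerBl scale1r [RHS]addrC -addrA addKr.
      apply: le_trans (ler_normD _ _) _; rewrite normrZ e1 mulr1.
      have : `|1 - 2 * h w| <= 1 by rewrite ler_norml; lra.
      by lra.
    apply: le_trans (ler_normB _ _) _; rewrite normrZ e1 mulr1 ger0_norm ?mulr_ge0//.
    have hw : h w < eta by apply: lt_le_trans (hU w (conj Cw nUw)) _; rewrite ge_min lexx orbT.
    by have := f1 w; lra.
  exists h; split.
    by apply: peakingS ph => [w []//|]; rewrite ge_min lexx.
  (* The point obtained for [h :: G] also serves [G], so it lies in [C], and it carries the lower
     bound for the new [h]. *)
  have [|y [By [ly Ly]]] := IH be ba.1 z (h :: G) Wz pfz.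
    by move=> g; rewrite inE => /predU1P[->//|]; exact: pGz.
  exists y; last by apply: Ly; exact: mem_head.
  by split => //; split => // g gG; apply: Ly; rewrite inE gG orbT.
- rewrite (cantor_derivative_limit wo B la).
  (* At a limit the earlier derivatives of [B] decrease, so these nonempty compact sets have a
     common point. *)
  pose F := [set cantor_derivative wo B be `&` large_images e f G | be in [set be | wlt r be al]].
  have Bne be : wlt r be al -> cantor_derivative wo B be `&` large_images e f G !=set0.
    move=> bal; apply: (IH be bal x G _ fx Gx); move: Wx.
    by rewrite (cantor_derivative_limit wo _ la); apply.
  have [be0 /contrapT be0al] : exists be, ~ ~ wlt r be al by apply/existsNP; exact: la.1.
  have [|D|D1 D2|y yF] := @compact_directed _ B F cB.
  + by eexists; exists be0.
  + move=> [bb /= h <-].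
    split; [|exact: Bne|by move=> y [+ _]; exact: cantor_derivative_sub].
    by apply: closedI => //; exact: closed_cantor_derivative.
  + move=> [be1 /= h1 <-] [be2 /= h2 <-]; have [<-|ne] := EM (be1 = be2).
      by eexists; [exists be1|move=> y].
    have [h|h] := well_order_total wo be1 be2.
      eexists; first by exists be2.
      by move=> y [By Ly]; split; split => //; apply: cantor_derivative_anti By.
    eexists; first by exists be1.
    move=> y [By Ly]; split; split => //; apply: cantor_derivative_anti By; split => //.
    exact/nesym.
  + exists y; split; first by move=> be bal; have [] := yF _ (ex_intro2 _ _ be bal erefl).
    by have [] := yF _ (ex_intro2 _ _ be0 be0al erefl).
Qed.

Lemma large_images_nonvanishing e f G y :
  H1 f -> large_images e f G y -> nonvanishing_points H2 y.
Proof.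
move=> Hf [ly _]; exists (T f); first exact: TH.
by rewrite -normr_gt0; exact: lt_le_trans c0 ly.
Qed.

Lemma peaking_peaks_at e x U h : `|e| = 1 -> peaking H1 x U eta h ->
  peaks_at e (tens h e) x.
Proof.
have p0 := eta0.
move=> e1 [mh h01 hx _]; split; first exact: multiplier_fspace.
  move=> z; have /andP[h0 h1] := h01 z.
  by rewrite normrZ e1 mulr1 ger0_norm//; lra.
rewrite -{2}[e]scale1r -scalerBl normrZ e1 mulr1.
by have /andP[h0 h1] := h01 x; rewrite ler0_norm; lra.
Qed.

Lemma min_eta01 eps : 0 < eps < 1 -> 0 < Num.min eps eta < 1.
Proof. by move=> /andP[eps0 eps1]; rewrite lt_min eps0 eta0 gt_min eta1 orbT. Qed.

(** * Comparison of derivatives of weak peak points and of the boundary *)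

Section derivatives.
Context {I : Type} {r : rel I} (wo : well_order r) (al : I).
Variables (e : E1) (e1 : `|e| = 1).

Let W := cantor_derivative wo (weak_peak_points H1) al.
Let Y := cantor_derivative wo B al `&` nonvanishing_points H2.

Lemma derivative_peak f x : W x -> peaks_at e f x -> exists2 y, Y y & c <= `|T f y|.
Proof.
move=> Wx fx; have [|y [By Ly]] := @peak_transfer I r wo al e f x [::] Wx e1 fx.
  by [].
exists y; last by case: Ly.
by split => //; apply: large_images_nonvanishing Ly; case: fx.
Qed.

(** One function must have error [eps] for [peaking_finite] and error [eta] for the transfer
    estimate. *)
Lemma derivative_peaking x U eps : W x -> nbhs x U -> 0 < eps < 1 ->
  exists h, peaking H1 x U eps h /\ peaking H1 x U eta h.
Proof.
move=> Wx Ux /min_eta01 mn; have Wpx := cantor_derivative_sub Wx.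
have [h ph] := Wpx U _ Ux mn.
by exists h; split; apply: peakingS ph => //; rewrite ge_min lexx ?orbT.
Qed.

Lemma derivative_nonempty : W !=set0 -> Y !=set0.
Proof.
move=> [x Wx].
have half01 : 0 < (2^-1 : R) < 1 by lra.
have [h [_ ph]] := derivative_peaking Wx filterT half01.
by have [y Yy _] := derivative_peak Wx (peaking_peaks_at e1 ph); exists y.
Qed.

Lemma derivative_finite : finite_set Y -> finite_set W.
Proof.
move=> Yfin; apply: (@peaking_finite e _ _ _ _ c0 Yfin); first by rewrite e1.
move=> x Wx U eps Ux eps01; have [h [ph1 ph2]] := derivative_peaking Wx Ux eps01.
exists h; split => //; exact: derivative_peak (peaking_peaks_at e1 ph2).
Qed.

(** For constant [f] the map [phi] sends [x] to one point serving all admissible [g] at [x]. Each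
    fibre of [phi] is finite by [peaking_finite] for a single point. *)
Lemma derivative_card_le : H1 (fun=> e) -> infinite_set Y -> W #<= Y.
Proof.
have p0 := eta0; move=> He Yinf.
have pe x : peaks_at e (fun=> e) x.
  by split => // [z|]; rewrite ?subrr ?normr0// e1; lra.
have [clB _] := bB.
have cBa : compact (cantor_derivative wo B al).
  have clBa : closed (cantor_derivative wo B al) by exact: closed_cantor_derivative.
  by apply: subclosed_compact clBa cK2 _.
have /choice[phi phiP] : forall x, exists y, W x -> Y y /\
    forall g, peaks_below e (fun=> e) x g -> c <= `|T (tens g e) y|.
  move=> x; have [Wx|nWx] := EM (W x); last first.
    by have [y Yy] := infinite_setN0 Yinf; exists y => /nWx.
  (* Finite lists are directed by concatenation, so compactness turns points serving each list into
     one point serving every [g]. *)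
  pose F := [set cantor_derivative wo B al `&` large_images e (fun=> e) G
    | G in [set G : seq (K1 -> R) |
        forall g, g \in G -> peaks_below e (fun=> e) x g]].
  have [|D|D1 D2|y yF] := @compact_directed _ _ F cBa.
  - by eexists; exists [::].
  - move=> [G GP <-]; split; [|exact: peak_transfer (pe x) GP|exact: subIsetl].
    apply: closedI; first exact: closed_cantor_derivative.
    by apply: closed_large_images => // g /GP[].
  - move=> [G1 GP1 <-] [G2 GP2 <-].
    exists (cantor_derivative wo B al `&` large_images e (fun=> e) (G1 ++ G2)).
      exists (G1 ++ G2) => // g; rewrite mem_cat => /orP[]; [exact: GP1|exact: GP2].
    move=> y [By [ly Ly]]; split; split => //; split => // g gG;
      by apply: Ly; rewrite mem_cat gG ?orbT.
  - exists y => _; split.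
      have [|By Ly] := yF (cantor_derivative wo B al `&` large_images e (fun=> e) [::]).
        by exists [::].
      by split => //; exact: large_images_nonvanishing Ly.
    move=> g gx.
    have [|_ [_ +]] := yF (cantor_derivative wo B al `&` large_images e (fun=> e) [:: g]).
      by exists [:: g] => // g'; rewrite inE => /eqP ->.
    by apply; exact: mem_head.
apply: (finite_fibres_card_le (f := phi)) => // [x /phiP[]//|y Yy].
apply: (@peaking_finite e c [set y] _ _ c0 (finite_set1 y)); first by rewrite e1.
move=> x [Wx phix] U eps Ux eps01.
have [h [ph1 ph2]] := derivative_peaking Wx Ux eps01.
exists h; split => //; exists y => //; rewrite -phix.
have [_] := phiP x Wx; apply; have [mh h01 hx _] := ph2; split => // z.
rewrite -{1}[e]scale1r -scalerBl normrZ e1 mulr1.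
have /andP[h0 h1] := h01 z.
have : `|1 - 2 * h z| <= 1 by rewrite ler_norml; lra.
by lra.
Qed.

End derivatives.

(** Send [u] to the values of [T (\sum_i h i u i)] at the points [y j]. After scaling a largest
    coordinate [u k] to norm 1, the sum peaks at [x k] towards [u k], so one value has norm at least
    [c], a constant independent of [u]. *)
Lemma derivative_contains_copy (I : Type) (r : rel I) (wo : well_order r) (al : I)
    (n m : nat) (x : 'I_n -> K1) (y : 'I_m -> K2) :
  (forall i, cantor_derivative wo (weak_peak_points H1) al (x i)) ->
  injective x ->
  (forall z, (cantor_derivative wo B al `&` nonvanishing_points H2) z ->
    exists j, y j = z) ->
  power_contains_copy m E2 n E1.
Proof.
have p0 := eta0; have p1 := eta1; move=> Wx xinj ysurj.
have /choice[D DP] : forall p : 'I_n * 'I_n, exists D : set K1 * set K1, p.1 != p.2 ->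
    [/\ nbhs (x p.1) D.1, nbhs (x p.2) D.2 & D.1 `&` D.2 = set0].
  move=> [i j] /=; have [->|ij] := eqVneq i j; first by exists (setT, setT).
  move: hK1; rewrite open_hausdorff => /(_ (x i) (x j)).
  rewrite (inj_eq xinj) => /(_ ij)[[A A'] /= [Ai A'j] [oA oA' AA']].
  exists (A, A') => _; split; last exact/eqP.
    by apply: open_nbhs_nbhs; split => //; exact/set_mem.
  by apply: open_nbhs_nbhs; split => //; exact/set_mem.
pose U i := [set z | forall j, i != j -> (D (i, j)).1 z /\ (D (j, i)).2 z].
have U_x i : nbhs (x i) (U i).
  apply: filter_forall => j; have [ij|_] := boolP (i != j); last by apply: filterE.
  have [Di _ _] := DP (i, j) ij.
  have [|_ Di' _] := DP (j, i); first by rewrite eq_sym.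
  by apply: filterS (filterI Di Di') => z [? ?].
have UU i j : i != j -> U i `&` U j = set0.
  move=> ij; rewrite -subset0 => z [Uiz Ujz].
  have [_ _ <-] := DP (i, j) ij; split; first by have [] := Uiz j ij.
  by have [|//] := Ujz i; rewrite eq_sym.
(* The [n] errors add up to [eta], as [peaks_at] requires of the sum. *)
have ex_h i : exists h, peaking H1 (x i) (U i) (eta / n%:R) h.
  apply: (cantor_derivative_sub (Wx i)) => //.
  have n1 : (1 : R) <= n%:R by rewrite ler1n; case: (n) i => // -[].
  have n0 : (0 : R) < n%:R by exact: lt_le_trans n1.
  rewrite divr_gt0//= ltr_pdivrMr// mul1r; exact: lt_le_trans n1.
have {ex_h}/choice[h hP] := ex_h.
pose F (u : 'I_n -> E1) : K1 -> E1 := \sum_i (fun z => h i z *: u i).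
have FE u z : F u z = \sum_i h i z *: u i by rewrite /F fct_sumE.
have HF u : H1 (F u) by apply: (fspace_sum sH1) => i; exact: peaking_fspace (hP i).
have Flin k u v : F (k *: u + v) = k *: F u + F v.
  apply/funext => z; rewrite !fctE !FE scaler_sumr -big_split/=.
  by apply: eq_bigr => i _; rewrite scalerDr !scalerA mulrC.
pose S (u : 'I_n -> E1) : 'I_m -> E2 := fun j => T (F u) (y j).
have Slin k u v : S (k *: u + v) = k *: S u + S v.
  by apply/funext => j; rewrite /S Flin Tlin.
have bnd (X : finType) (V : normedModType R) (u : X -> V) i : `|u i| <= supnorm u.
  apply: (@supnorm_ub _ _ _ _ (\sum_j `|u j|)) => j.
  by rewrite (bigD1 j)//= lerDl sumr_ge0.
have Sge_unit u k : `|u k| = 1 -> (forall i, `|u i| <= 1) -> c <= supnorm (S u).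
  move=> uk u1.
  have n0 : n%:R != 0 :> R by rewrite pnatr_eq0; case: (n) k {uk} => // -[].
  have sum_eps : \sum_(i < n) eta / n%:R = eta.
    by rewrite sumr_const card_ord -[_ *+ _]mulr_natr divfK.
  have pu : peaks_at (u k) (F u) (x k).
    split => // [z|].
      apply: (peaking_sum_le cK1 sH1 (x := x) (U := U) (eps := fun=> eta / n%:R)) => //.
      - exact: index_enum_uniq.
      - by move=> i j _ _; exact: UU.
      - by move=> i _; rewrite divr_ge0// ltW.
      - by rewrite sum_eps.
    rewrite FE (bigD1 k)//= addrAC.
    have -> : h k (x k) *: u k - u k = (h k (x k) - 1) *: u k.
      by rewrite scalerBl scale1r.
    apply: le_lt_trans (ler_normD _ _) _.
    rewrite -[X in _ < X]sum_eps [X in _ < X](bigD1 k)//= ltr_leD//.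
      have [_ h01 hx _] := hP k; have /andP[h0 h1] := h01 (x k).
      by rewrite normrZ uk mulr1 ler0_norm; lra.
    apply: le_trans (ler_norm_sum _ _ _) _; apply: ler_sum => i ik.
    have [_ h01 _ _] := hP i; have /andP[h0 h1] := h01 (x k).
    rewrite normrZ ger0_norm//; apply: le_trans (ler_piMr h0 (u1 i)) _.
    by apply: (peaking_small cK1 sH1 (hP i)) (cantor_derivative_sub (Wx k)) (U_x k) (UU _ _ ik).
  have [z Yz Tz] := derivative_peak uk (Wx k) pu.
  have [j yj] := ysurj z Yz; apply: le_trans (bnd _ _ (S u) j).
  by rewrite /S yj.
have S0 : S 0 = 0.
  by have := Slin (-1) 0 0; rewrite addr0 scaler0 scaleN1r addNr.
have SZ k u : S (k *: u) = k *: S u by have := Slin k u 0; rewrite !addr0 S0 addr0.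
have Sge u : supnorm u <= c^-1 * supnorm (S u).
  apply: supnorm_le => [|i]; first by rewrite mulr_ge0 ?invr_ge0 ?supnorm_ge0// ltW.
  case: (@arg_maxP _ _ _ i xpredT (fun i => `|u i|)) => // k _ kmax.
  have [uk0|uk0] := eqVneq `|u k| 0.
    apply: (@le_trans _ _ 0); first by rewrite -uk0; exact: kmax.
    by rewrite mulr_ge0 ?invr_ge0 ?supnorm_ge0// ltW.
  have ukgt : 0 < `|u k| by rewrite lt_def uk0 normr_ge0.
  have := Sge_unit (`|u k|^-1 *: u) k; rewrite SZ supnormZ; last first.
    by exists (supnorm (S u)) => j; exact: bnd.
  have nZ j : `|(`|u k|^-1 *: u) j| = `|u k|^-1 * `|u j|.
    by rewrite normrZ normfV normr_id.
  rewrite nZ mulVf// => /(_ erefl) hk.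
  have : c <= `| `|u k|^-1 | * supnorm (S u).
    apply: hk => j; rewrite nZ ler_pdivrMl// mulr1; exact: kmax.
  rewrite normfV normr_id ler_pdivlMl// => ck.
  by apply: le_trans (kmax i isT) _; rewrite ler_pdivlMl// mulrC.
exists S; apply: (into_isomorphism_of_bounds (M := a * n%:R) (C := c^-1)) => //.
- move=> u v _ _ Suv; apply/funext => i.
  have := le_trans (bnd _ _ (u - v) i) (Sge (u - v)).
  have -> : S (u - v) = 0 by rewrite addrC -scaleN1r Slin Suv scaleN1r addNr.
  have -> : supnorm (0 : 'I_m -> E2) = 0.
    by apply/le_anti; rewrite supnorm_ge0 andbT supnorm_le// => j; rewrite normr0.
  by rewrite mulr0 normr_le0 subr_eq0 => /eqP.
- move=> u _; apply: supnorm_le => [|j].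
    by rewrite !mulr_ge0 ?supnorm_ge0// ltW.
  rewrite -mulrA; apply: emb_norm_le => // [|z]; first by rewrite mulr_ge0 ?supnorm_ge0.
  rewrite FE; apply: le_trans (ler_norm_sum _ _ _) _.
  apply: (@le_trans _ _ (\sum_(i < n) supnorm u)); last first.
    by rewrite sumr_const card_ord mulr_natl.
  apply: ler_sum => i _; have [_ h01 _ _] := hP i; have /andP[h0 h1] := h01 z.
  rewrite normrZ ger0_norm//; apply: le_trans (bnd _ _ u i).
  exact: ler_piMl.
Qed.

End transfer.

(** * Dimension of finite powers *)

(** A vector in the left kernel of the coordinate matrix gives a linear relation among the [u i];
    hence the matrix has full row rank, which is at most its number of columns. *)
Lemma independent_card_le (R : realType) (V : lmodType R) (I J : finType)
    (u : I -> V) (w : J -> V) (M : I -> J -> R) :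
  (forall i, u i = \sum_j M i j *: w j) ->
  (forall x : I -> R, \sum_i x i *: u i = 0 -> forall i, x i = 0) ->
  (#|I| <= #|J|)%N.
Proof.
move=> uE ind.
pose A : 'M[R]_(#|I|, #|J|) := \matrix_(p, q) M (enum_val p) (enum_val q).
suff : row_free A by rewrite /row_free => /eqP <-; exact: rank_leq_col.
apply: inj_row_free => v vA0; apply/rowP => p; rewrite mxE.
have := ind (fun i => v 0 (enum_rank i)) _ (enum_val p).
rewrite enum_valK; apply.
under eq_bigr do rewrite uE scaler_sumr.
rewrite exchange_big/= big1// => j _.
under eq_bigr do rewrite scalerA.
rewrite -scaler_suml.
have -> : \sum_i v 0 (enum_rank i) * M i j = (v *m A) 0 (enum_rank j).
  rewrite mxE (reindex_onto enum_rank enum_val) => [|q _]; last exact: enum_valK.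
  rewrite /= [RHS](eq_bigl xpredT) => [|i]; last by rewrite enum_rankK eqxx.
  by apply: eq_bigr => i _; rewrite !mxE !enum_rankK.
by rewrite vA0 mxE scale0r.
Qed.

(** Take a spanning family of least length: a relation with a nonzero coefficient at [k] would
    express [g k] by the others and shorten it. *)
Lemma finite_dimensional_basis (R : realType) (V : lmodType R) :
  finite_dimensional V -> exists (d : nat) (g : 'I_d -> V),
    (forall v, exists c : 'I_d -> R, v = \sum_i c i *: g i) /\
    (forall c : 'I_d -> R, \sum_i c i *: g i = 0 -> forall i, c i = 0).
Proof.
move=> [G [Gfin Gspan]].
pose spans d := `[< exists g : 'I_d -> V,
  forall v, exists c : 'I_d -> R, v = \sum_i c i *: g i >].
have ex_d : exists d, spans d.
  have [s Gs] := (finite_seqP G).1 Gfin.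
  exists (size s); apply/asboolP; exists (fun i => s`_i) => v.
  have [n [c [k [kG ->]]]] : linear_span G v by rewrite Gspan.
  elim/big_ind: _ => [|x y [cx ->] [cy ->]|j _].
  - by exists (fun=> 0); rewrite big1// => i _; rewrite scale0r.
  - exists (fun i => cx i + cy i); rewrite -big_split/=.
    by apply: eq_bigr => i _; rewrite scalerDl.
  - have ks : k j \in s by have := kG j; rewrite Gs.
    have ltk : (index (k j) s < size s)%N by rewrite index_mem.
    exists (fun i => if i == Ordinal ltk then c j else 0).
    rewrite (bigD1 (Ordinal ltk))//= eqxx nth_index// big1 ?addr0// => i /negbTE ->.
    by rewrite scale0r.
case: (ex_minnP ex_d) => d /asboolP[g gspan] dmin.
exists d, g; split => // c c0 k; apply: contrapT => /eqP ck.
case: d g gspan dmin c c0 k ck => [|d] g gspan dmin c c0 k ck; first by case: k {ck}.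
suff /dmin : spans d by rewrite ltnn.
apply/asboolP; exists (g \o lift k) => v; have [x ->] := gspan v.
have gk : g k = \sum_(i < d) (- (c (lift k i) / c k)) *: g (lift k i).
  apply: (@scalerI _ _ (c k)) => //; rewrite scaler_sumr.
  move: c0; rewrite (bigD1_ord k)//= => /eqP; rewrite addr_eq0 => /eqP ->.
  rewrite -sumrN; apply: eq_bigr => i _.
  by rewrite scalerA mulrN mulrCA divff// mulr1 scaleNr.
exists (fun i => x (lift k i) - x k * (c (lift k i) / c k)).
rewrite (bigD1_ord k)//= gk scaler_sumr -big_split/=.
by apply: eq_bigr => i _; rewrite scalerA -scalerDl mulrN addrC.
Qed.

(** The images of the [n * d] standard basis vectors are independent in a space spanned by [m * d]
    vectors; a nonzero vector ensures [d > 0], so [d] cancels. *)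
Lemma power_injection_le (R : realType) (V : lmodType R) (n m : nat)
    (S : ('I_n -> V) -> 'I_m -> V) :
  linear_on setT S -> {in [set: 'I_n -> V] &, injective S} ->
  finite_dimensional V -> (exists v : V, v != 0) -> (n <= m)%N.
Proof.
move=> Slin Sinj /finite_dimensional_basis[d [g [gspan gind]]] [v v0].
have d_gt0 : (0 < d)%N.
  have [c vE] := gspan v; case: d g gspan gind c vE => // g _ _ c vE.
  by move: v0; rewrite vE big_ord0 eqxx.
have S0 : S 0 = 0.
  by have := Slin (-1) 0 0 I I; rewrite addr0 scaler0 scaleN1r addNr.
have SD x y : S (x + y) = S x + S y by have := Slin 1 x y I I; rewrite !scale1r.
have SZ a x : S (a *: x) = a *: S x by have := Slin a x 0 I I; rewrite !addr0 S0 addr0.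
have Ssum (J : finType) (F : J -> 'I_n -> V) : S (\sum_j F j) = \sum_j S (F j).
  exact: (big_morph S SD S0).
pose delta k (i : 'I_k) (x : V) : 'I_k -> V := fun j => if j == i then x else 0.
have /choice[c cP] := gspan.
suff : (#|{: 'I_n * 'I_d}| <= #|{: 'I_m * 'I_d}|)%N.
  by rewrite !card_prod !card_ord leq_pmul2r.
apply: (@independent_card_le R ('I_m -> V) _ _ (fun p => S (delta n p.1 (g p.2)))
  (fun q => delta m q.1 (g q.2)) (fun p q => c (S (delta n p.1 (g p.2)) q.1) q.2)).
  move=> p; apply/funext => j; rewrite fct_sumE.
  rewrite -(pair_bigA _ (fun j' k => (c (S (delta n p.1 (g p.2)) j') k *: delta m j' (g k)) j))/=.
  rewrite (bigD1 j)//= [X in _ + X]big1 ?addr0 => [|j' /negbTE jj'].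
    by rewrite {1}[S _ j]cP; apply: eq_bigr => k _; rewrite /delta !fctE eqxx.
  by apply: big1 => k _; rewrite /delta !fctE eq_sym jj' scaler0.
move=> x x0 [i k].
have : \sum_p x p *: delta n p.1 (g p.2) = 0.
  apply: Sinj; rewrite ?inE// S0 Ssum -[RHS]x0.
  by apply: eq_bigr => p _; rewrite SZ.
move=> /(congr1 (fun f => f i)); rewrite fct_sumE.
rewrite (eq_bigr (fun p => (x (p.1, p.2) *: delta n p.1 (g p.2)) i)); last by case.
rewrite -(pair_bigA _ (fun i' k => (x (i', k) *: delta n i' (g k)) i))/=.
rewrite (bigD1 i)//= [X in _ + X]big1 ?addr0 => [|i' /negbTE ii'].
  move=> h; apply: (gind (fun k => x (i, k))); rewrite -[RHS]h.
  by apply: eq_bigr => k' _; rewrite /delta !fctE eqxx.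
by apply: big1 => k' _; rewrite /delta !fctE eq_sym ii' scaler0.
Qed.

Lemma power_contains_copy_le (R : realType) (E E' : completeNormedModType R)
    (n m : nat) :
  E = E' -> power_contains_copy m E' n E -> finite_dimensional E ->
  (exists e : E, e != 0) -> (n <= m)%N.
Proof. by case: _ / => -[S [Slin _ Sinj _ _]]; exact: power_injection_le Slin Sinj. Qed.

Lemma finite_set_enum (T : Type) (A : set T) : finite_set A ->
  exists (n : nat) (x : 'I_n -> T), [/\ A #= `I_n, injective x,
    forall i, A (x i) & forall t, A t -> exists i, x i = t].
Proof.
move=> /finite_setP[n An]; exists n.
have /card_set_bijP[f [fA finj fsurj]] := An.
have /choice[x xP] : forall i : 'I_n, exists t, A t /\ f t = i.
  by move=> i; have [t At ft] := fsurj i (ltn_ord i); exists t.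
exists x; split => // [i j xij|i|t At].
- by apply/val_inj; rewrite /= -(xP i).2 -(xP j).2 xij.
- by have [] := xP i.
- have fn : (f t < n)%N := fA t At.
  exists (Ordinal fn); have [Ax fx] := xP (Ordinal fn).
  by apply: finj; rewrite ?inE.
Qed.

(** * Choice of the constants and the four conclusions *)

Theorem theorem1p1 (R : realType) (K1 K2 : topologicalType)
    (E1 E2 : completeNormedModType R)
    (hK1 : hausdorff_space K1) (cK1 : compact [set: K1])
    (hK2 : hausdorff_space K2) (cK2 : compact [set: K2])
    (dE1 : exists e : E1, e != 0) (dE2 : exists e : E2, e != 0)
    (H1 : set (K1 -> E1)) (H2 : set (K2 -> E2))
    (sH1 : closed_function_subspace H1) (sH2 : closed_function_subspace H2)
    (dH1 : exists2 h, H1 h & h <> 0) (dH2 : exists2 h, H2 h & h <> 0)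
    (nc0 : ~ contains_c0 E2)
    (B : set K2) (bB : closed_boundary_for H2 B)
    (T : (K1 -> E1) -> (K2 -> E2))
    (isoT : into_isomorphism H1 (@supnorm R K1 E1) H2 (@supnorm R K2 E2) T)
    (T3 : opnorm H1 (@supnorm R K1 E1) (@supnorm R K2 E2) T *
          opnorm (T @` H1) (@supnorm R K2 E2) (@supnorm R K1 E1)
            (range_inv H1 T) < 3) :
  [/\ forall (I : Type) (r : rel I) (wo : well_order r) (a : I),
        cantor_derivative wo (weak_peak_points H1) a !=set0 ->
        cantor_derivative wo B a `&` nonvanishing_points H2 !=set0,
      forall (I : Type) (r : rel I) (wo : well_order r) (a : I),
        finite_set (cantor_derivative wo B a `&` nonvanishing_points H2) ->
        finite_set (cantor_derivative wo (weak_peak_points H1) a),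
      forall (I : Type) (r : rel I) (wo : well_order r) (a : I),
        finite_set (cantor_derivative wo B a `&` nonvanishing_points H2) ->
        exists n m : nat,
          [/\ cantor_derivative wo (weak_peak_points H1) a #= `I_n,
              cantor_derivative wo B a `&` nonvanishing_points H2 #= `I_m,
              power_contains_copy m E2 n E1 &
              E1 = E2 -> finite_dimensional E1 -> (n <= m)%N] &
      (forall e : E1, H1 (fun=> e)) ->
      forall (I : Type) (r : rel I) (wo : well_order r) (a : I),
        infinite_set (cantor_derivative wo B a `&` nonvanishing_points H2) ->
        cantor_derivative wo (weak_peak_points H1) a #<=
          cantor_derivative wo B a `&` nonvanishing_points H2].
Proof.
have [Tlin TH Tinj Tbnd Tinvbnd] := isoT.
set a := opnorm H1 _ _ T in T3; set b := opnorm _ _ _ (range_inv H1 T) in T3.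
have invE u : H1 u -> range_inv H1 T (T u) = u.
  by move=> Hu; rewrite /range_inv pinvKV ?inE.
have TZ (k : R) u : H1 u -> T (k *: u) = k *: T u := embZ sH1 Tlin k (u := u).
have Ta u : H1 u -> supnorm (T u) <= a * supnorm u.
  apply: opnorm_bound => //.
  - by move=> *; exact: supnorm_ge0.
  - by move=> k v; exact: (fspaceZ sH1).
  - by move=> k v Hv; apply: supnormZ; exact: (fspace_bounded cK1 sH1).
  - move=> k v Hv; rewrite TZ//; apply: supnormZ.
    by apply: (fspace_bounded cK2 sH2); exact: TH.
have Tb u : H1 u -> supnorm u <= b * supnorm (T u).
  move=> Hu; rewrite -{1}(invE u Hu).
  have DTu : (T @` H1) (T u) by exists u.
  apply: (opnorm_bound (N := @supnorm R K2 E2) (N' := @supnorm R K1 E1)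
    (D := T @` H1) (T := range_inv H1 T)) => //.
  - by move=> *; exact: supnorm_ge0.
  - by move=> k _ [v Hv <-]; exists (k *: v); [exact: (fspaceZ sH1)|exact: TZ].
  - move=> k _ [v Hv <-]; apply: supnormZ.
    by apply: (fspace_bounded cK2 sH2); exact: TH.
  - move=> k _ [v Hv <-]; rewrite -TZ// !invE//; last exact: (fspaceZ sH1).
    by apply: supnormZ; exact: (fspace_bounded cK1 sH1).
(* A nonzero [h0] has a nonzero image, and the two norm estimates at [h0] then force [b] and [a] to
   be positive. *)
have [h0 Hh0 h0n0] := dH1.
have h0pos : 0 < supnorm h0.
  rewrite lt_def supnorm_ge0 andbT; apply/eqP => s0; apply: h0n0.
  apply/funext => x; apply/eqP; rewrite -normr_le0 -s0.
  exact: (fspace_supnorm_ge cK1 sH1).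
have bTh : 0 < b * supnorm (T h0) := lt_le_trans h0pos (Tb _ Hh0).
have Th0pos : 0 < supnorm (T h0).
  rewrite lt_def supnorm_ge0 andbT; apply/eqP => s0.
  by move: bTh; rewrite s0 mulr0 ltxx.
have b0 : 0 < b by move: bTh; rewrite pmulr_lgt0.
have a0 : 0 < a by have := lt_le_trans Th0pos (Ta _ Hh0); rewrite pmulr_lgt0.
have ab0 : 0 < a * b := mulr_gt0 a0 b0.
(* 3 - a b - eta (6 + 5 a b) >= (3 - a b) / 2, because 6 + 5 a b < 21. *)
pose eta := (3 - a * b) / 42; pose c := (3 - a * b) / (4 * b).
have eta0 : 0 < eta by rewrite /eta; lra.
have eta1 : eta < 1 by rewrite /eta; lra.
have c0 : 0 < c by rewrite divr_gt0 ?subr_gt0// mulr_gt0.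
have etac : b * (2 * c + a * (1 + 5 * eta)) <= 3 * (1 - 2 * eta).
  have -> : b * (2 * c + a * (1 + 5 * eta)) =
      (3 - a * b) / 2 + (a * b) * (1 + 5 * eta).
    by rewrite /c; field; rewrite gt_eqF.
  have : (a * b) * eta <= 3 * eta by rewrite ler_wpM2r// ltW.
  by rewrite mulrDr mulr1 mulrCA /eta; lra.
have [e e1] : exists e : E1, `|e| = 1.
  have [e e0] := dE1; exists (`|e|^-1 *: e).
  by rewrite normrZ normfV normr_id mulVf// normr_eq0.
pose D := derivative_finite hK1 cK1 cK2 sH1 sH2 nc0 bB Tlin TH Ta Tb a0 b0 eta0 eta1 c0 etac.
split.
- move=> I r wo al; exact: (derivative_nonempty hK1 cK1 cK2 sH1 sH2 nc0 bB Tlin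
    TH Ta Tb a0 b0 eta0 eta1 c0 etac e1).
- move=> I r wo al; exact: D e1.
- move=> I r wo al Yfin.
  have [n [x [Wn xinj xW xsurj]]] := finite_set_enum (D _ _ wo al _ e1 Yfin).
  have [m [y [Ym yinj yY ysurj]]] := finite_set_enum Yfin.
  have copy : power_contains_copy m E2 n E1.
    exact: (derivative_contains_copy hK1 cK1 cK2 sH1 sH2 nc0 bB Tlin
      TH Ta Tb a0 b0 eta0 eta1 c0 etac xW xinj ysurj).
  exists n, m; split => // E12 fd; exact: power_contains_copy_le E12 copy fd dE1.
- move=> cst I r wo al; exact: (derivative_card_le hK1 cK1 cK2 sH1 sH2 nc0 bB Tlin
    TH Ta Tb a0 b0 eta0 eta1 c0 etac e1 (cst e)).
Qed.
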